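(* For every $A\in\mathrm{Mat}_{m,n}$, $$\dim_H\mathrm{Sing}_A(\psi_{n/m})\le m\,\frac{d-1}{d}\,\underline{\mathrm{Emass}}(A).$$
   Context: Let $m,n\in\mathbb N$, $d=m+n$, $\mathbb R_+=(0,\infty)$, and let $\mathrm{Mat}_{m,n}$ be the set of real $m\times n$ matrices. $|\cdot|$ is the supremum norm. $\mathbb T^m=\mathbb R^m/\mathbb Z^m$ carries the quotient supremum metric, and $\dim_H$ is Hausdorff dimension. For a function $\psi:\mathbb R_+\to\mathbb R_+$, $D_A(\psi)$ is the set of $\mathbf b\in\mathbb T^m$ such that for every sufficiently large real $T$ there is $(\mathbf p,\mathbf q)\in\mathbb Z^m\times\mathbb Z^n$ with $|A\mathbf q-\mathbf p-\mathbf b|\le\psi(T)$ and $|\mathbf q|\le T$. $\psi_\tau(T):=T^{-\tau}$, and $\mathrm{Sing}_A(\psi_\tau):=\bigcap_{c>0}D_A(c\psi_\tau)$. $u_A=\begin{pmatrix}I_m&A\\0&I_n\end{pmatrix}$, $a_t=\mathrm{diag}(e^{t/m}I_m,e^{-t/n}I_n)$, and $\lambda_1(t)$ is the first successive minimum (shortest nonzero vector length in the supremum norm) of the lattice $a_tu_A\mathbb Z^d$. The lower escape of mass is $$\underline{\mathrm{Emass}}(A):=\lim_{\delta\searrow0}\liminf_{R\to\infty}\frac1R\,\mathcal L^1\bigl(\{t\in[0,R]:\lambda_1(t)\le\delta\}\bigr),$$ where $\mathcal L^1$ is Lebesgue measure on $\mathbb R$. *)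

(* Defs.v *)
From HB Require Import structures.
From mathcomp Require Import all_boot all_order all_algebra.
From mathcomp Require Import all_classical all_reals all_analysis.
From mathcomp Require Import ring.

Set Implicit Arguments.
Unset Strict Implicit.
Unset Printing Implicit Defensive.

Import Order.TTheory GRing.Theory Num.Theory.
Import numFieldNormedType.Exports.

Local Open Scope classical_set_scope.
Local Open Scope ring_scope.
Local Open Scope quotient_scope.

(* The norm `|_| on matrices is the library's one, i.e. the supremum norm. *)

Definition intmx (R : realType) (k l : nat) (p : 'M[int]_(k, l)) : 'M[R]_(k, l) :=
  map_mx intr p.
Arguments intmx R {k l} p.

Section Torus.
Variables (R : realType) (m : nat).
Implicit Types (x y z : 'cV[R]_m) (p q : 'cV[int]_m).

Definition torus_eqv x y : bool :=
  `[< exists p, x - y = intmx R p >].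

Lemma intmxB p q : intmx R (p - q) = intmx R p - intmx R q.
Proof. exact: map_mxB. Qed.

Lemma intmxD p q : intmx R (p + q) = intmx R p + intmx R q.
Proof. exact: map_mxD. Qed.

Lemma intmxN p : intmx R (- p) = - intmx R p.
Proof. exact: map_mxN. Qed.

Lemma intmx0 : intmx R (0 : 'cV_m) = 0.
Proof. exact: map_mx0. Qed.

Lemma torus_eqv_refl : reflexive torus_eqv.
Proof. by move=> x; apply/asboolP; exists 0; rewrite intmx0 subrr. Qed.

Lemma torus_eqv_sym : symmetric torus_eqv.
Proof.
suff h x y : torus_eqv x y -> torus_eqv y x.
  by move=> x y; apply/idP/idP; exact: h.
by move=> /asboolP[p e]; apply/asboolP; exists (- p); rewrite intmxN -e opprB.
Qed.

Lemma torus_eqv_trans : transitive torus_eqv.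
Proof.
move=> y x z /asboolP[p e] /asboolP[q f]; apply/asboolP; exists (p + q).
by rewrite intmxD -e -f addrA subrK.
Qed.

Canonical torus_equiv :=
  EquivRel torus_eqv torus_eqv_refl torus_eqv_sym torus_eqv_trans.

Definition torus : Type := {eq_quot torus_eqv}.
HB.instance Definition _ := Choice.on torus.
HB.instance Definition _ := EqQuotient.on torus.

Lemma torus_piP x y :
  reflect (exists p, x - y = intmx R p) (\pi_torus x == \pi_torus y).
Proof. by rewrite piE; exact: asboolP. Qed.

Definition torus_dist (b c : torus) : R :=
  inf [set `|repr b - repr c - intmx R p| | p in [set: 'cV[int]_m]].

Lemma torus_repr x : exists p, repr (\pi_torus x) = x + intmx R p.
Proof.
have /torus_piP[p e] : \pi_torus (repr (\pi_torus x)) == \pi_torus x by rewrite reprK.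
by exists p; rewrite -e addrC subrK.
Qed.

(* The distance does not depend on the representatives. *)
Lemma torus_distE x y : torus_dist (\pi_torus x) (\pi_torus y) =
  inf [set `|x - y - intmx R p| | p in [set: 'cV[int]_m]].
Proof.
rewrite /torus_dist; have [p ->] := torus_repr x; have [q ->] := torus_repr y.
congr inf; apply/seteqP; split=> _ [r _ <-].
  exists (r - p + q) => //; congr `|_|; rewrite intmxD intmxB.
  by apply/matrixP => i j; rewrite !mxE; ring.
exists (r + p - q) => //; congr `|_|; rewrite intmxB intmxD.
by apply/matrixP => i j; rewrite !mxE; ring.
Qed.

Lemma torus_dist_le (b c : torus) p :
  torus_dist b c <= `|repr b - repr c - intmx R p|.
Proof.
by apply: ge_inf; [exists 0 => _ [q _ <-]; exact: normr_ge0|exists p].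
Qed.

Lemma torus_dist_lt (b c : torus) (e : R) : torus_dist b c < e ->
  exists p, `|repr b - repr c - intmx R p| < e.
Proof.
move=> be; have [] := @inf_adherent R
  [set `|repr b - repr c - intmx R p| | p in [set: 'cV[int]_m]]
  (e - torus_dist b c).
- by rewrite subr_gt0.
- split; first by exists `|repr b - repr c - intmx R 0|, 0.
  by exists 0 => _ [q _ <-]; exact: normr_ge0.
- by move=> _ [p _ <-]; rewrite -/(torus_dist b c) [ltRHS]addrC subrK => h; exists p.
Qed.

Lemma torus_dist_ge0 (b c : torus) : 0 <= torus_dist b c.
Proof.
apply: lb_le_inf; first by exists `|repr b - repr c - intmx R 0|, 0.
by move=> _ [q _ <-]; exact: normr_ge0.
Qed.

Lemma torus_distxx (b : torus) : torus_dist b b = 0.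
Proof.
apply/eqP; rewrite eq_le torus_dist_ge0 andbT.
by apply: le_trans (torus_dist_le b b 0) _; rewrite intmx0 !subrr normr0.
Qed.

Lemma torus_dist_sym (b c : torus) : torus_dist b c = torus_dist c b.
Proof.
suff h (b' c' : torus) : torus_dist b' c' <= torus_dist c' b'.
  by apply/eqP; rewrite eq_le !h.
rewrite leNgt; apply/negP => /torus_dist_lt[p]; rewrite ltNge => /negP; apply.
apply: le_trans (torus_dist_le _ _ (- p)) _.
by rewrite intmxN opprK -[leRHS]normrN !opprB addrC addrA.
Qed.

Lemma torus_dist_triangle (c b e : torus) :
  torus_dist b e <= torus_dist b c + torus_dist c e.
Proof.
rewrite leNgt; apply/negP; rewrite -subr_gt0 => h.
set k := _ - _ in h.
have k2 : 0 < k / 2 by rewrite divr_gt0.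
have [p hp] : exists p, `|repr b - repr c - intmx R p| < torus_dist b c + k / 2.
  by apply: torus_dist_lt; rewrite ltrDl.
have [q hq] : exists q, `|repr c - repr e - intmx R q| < torus_dist c e + k / 2.
  by apply: torus_dist_lt; rewrite ltrDl.
have := torus_dist_le b e (p + q).
have -> : repr b - repr e - intmx R (p + q) =
    (repr b - repr c - intmx R p) + (repr c - repr e - intmx R q).
  by rewrite intmxD; apply/matrixP => i j; rewrite !mxE; ring.
move=> /le_lt_trans/(_ (le_lt_trans (ler_normD _ _) (ltrD hp hq))).
by rewrite addrACA -splitr /k addrC subrK ltxx.
Qed.

Lemma intmx_small p : `|intmx R p| < 1 -> p = 0.
Proof.
move=> p1; apply/matrixP => i j; rewrite !mxE; apply/eqP.
apply: contraTT p1 => pij.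
rewrite -leNgt [leRHS]/Num.norm/= mx_normrE.
apply: (@le_trans _ _ `|intmx R p i j|).
  by rewrite mxE -intr_norm ler1z -gtz0_ge1 normr_gt0.
exact: (le_bigmax _ (fun ij => `|intmx R p ij.1 ij.2|) (i, j)).
Qed.

Lemma torus_dist_eq0 (b c : torus) : torus_dist b c = 0 -> b = c.
Proof.
move=> bc0.
have h2 : torus_dist b c < 1 / 2 by rewrite bc0 divr_gt0.
have [p hp] := torus_dist_lt h2.
suff e : repr b - repr c - intmx R p = 0.
  apply/eqP; rewrite -[b]reprK -[c]reprK; apply/torus_piP; exists p.
  by apply/eqP; rewrite -subr_eq0 e.
apply/eqP; rewrite -normr_eq0 eq_le normr_ge0 andbT leNgt; apply/negP => gt0.
have : torus_dist b c < Num.min (1 / 2) `|repr b - repr c - intmx R p|.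
  by rewrite bc0 lt_min gt0 divr_gt0.
move=> /torus_dist_lt[q]; rewrite lt_min => /andP[hq].
suff -> : q = p by rewrite ltxx.
apply/eqP; rewrite -subr_eq0; apply/eqP/intmx_small; rewrite intmxB.
have -> : intmx R q - intmx R p =
    (repr b - repr c - intmx R p) - (repr b - repr c - intmx R q).
  by rewrite opprB [RHS]addrC [RHS]addrA subrK.
by apply: le_lt_trans (ler_normB _ _) _; rewrite [ltRHS](splitr 1) ltrD.
Qed.

HB.instance Definition _ := isMetric.Build R torus
  torus_distxx torus_dist_eq0 torus_dist_sym torus_dist_triangle.

End Torus.

Section Hausdorff.
Variables (R : realType) (X : metricType R).
Implicit Types (E U : set X) (F : (set X)^nat) (s delta : R).
Local Open Scope ereal_scope.

Definition ediam U : \bar R :=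
  ereal_sup [set (mdist u.1 u.2)%:E | u in U `*` U].

(* diam(U)^s, with value 0 at the empty set, also for s = 0 *)
Definition diam_pow s U : \bar R :=
  if U == set0 then 0 else ediam U `^ s.

Definition delta_cover delta E : set ((set X)^nat) :=
  [set F | E `<=` \bigcup_i F i /\ forall i, ediam (F i) <= delta%:E].

Definition hausdorff_premeasure s delta E : \bar R :=
  ereal_inf [set \sum_(0 <= i <oo) diam_pow s (F i) | F in delta_cover delta E].

Definition hausdorff_measure s E : \bar R :=
  ereal_sup [set hausdorff_premeasure s delta E | delta in [set x | (0 < x)%R]].

Definition hausdorff_dim E : \bar R :=
  ereal_inf [set s%:E | s in [set s | (0 <= s)%R /\ hausdorff_measure s E = 0]].

End Hausdorff.

Section SingularSets.
Variables (R : realType) (m n : nat) (A : 'M[R]_(m, n)).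

Definition Dset (psi : R -> R) : set (torus R m) :=
  [set b | \forall T \near +oo, exists (p : 'cV[int]_m) (q : 'cV[int]_n),
    `|A *m intmx R q - intmx R p - repr b| <= psi T /\ `|intmx R q| <= T].

(* Membership can be tested on any representative. *)
Lemma Dset_pi (psi : R -> R) (x : 'cV[R]_m) : Dset psi (\pi_(torus R m) x) <->
  \forall T \near +oo, exists (p : 'cV[int]_m) (q : 'cV[int]_n),
    `|A *m intmx R q - intmx R p - x| <= psi T /\ `|intmx R q| <= T.
Proof.
rewrite /Dset/=; have [r ->] := torus_repr x.
split; apply: filterS => T [p [q [h qT]]].
  exists (p + r), q; split => //; move: h; rewrite intmxD.
  by congr (`|_| <= _); apply/matrixP => i j; rewrite !mxE; ring.
exists (p - r), q; split => //; move: h; rewrite intmxB.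
by congr (`|_| <= _); apply/matrixP => i j; rewrite !mxE; ring.
Qed.

Definition psi_pow (tau : R) : R -> R := fun T => T `^ (- tau).

Definition Sing (psi : R -> R) : set (torus R m) :=
  \bigcap_(c in [set c : R | 0 < c]) Dset (fun T => c * psi T).

End SingularSets.

Section Emass.
Variables (R : realType).

Definition uA (m n : nat) (A : 'M[R]_(m, n)) : 'M[R]_(m + n) :=
  block_mx 1%:M A 0 1%:M.

Definition aflow (m n : nat) (t : R) : 'M[R]_(m + n) :=
  block_mx (expR (t / m%:R))%:M 0 0 (expR (- t / n%:R))%:M.

Definition lattice_of (d : nat) (g : 'M[R]_d) : set 'cV[R]_d :=
  [set g *m intmx R v | v in [set: 'cV[int]_d]].

Definition first_minimum (d : nat) (L : set 'cV[R]_d) : R :=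
  inf [set `|v| | v in L `\ 0].

Definition lambda1 (m n : nat) (A : 'M[R]_(m, n)) (t : R) : R :=
  first_minimum (lattice_of (aflow m n t *m uA A)).

Local Open Scope ereal_scope.

Definition escape_freq (m n : nat) (A : 'M[R]_(m, n)) (delta r : R) : \bar R :=
  (r^-1)%:E * lebesgue_measure
    [set t | t \in `[0%R, r] /\ (lambda1 A t <= delta)%R].

Definition lower_Emass (m n : nat) (A : 'M[R]_(m, n)) : \bar R :=
  lim (limf_einf (escape_freq A delta) (pinfty_nbhs R) @[delta --> 0^'+]).

End Emass.

(* Main.v *)
(* Write g_t = a_t u_A. If b is singular then, for every eps > 0 and all large
   t, the grid g_t (Z^d - (b, 0)) has a vector of norm at most eps; cover the
   set of such b by pieces of diameter O(eps e^(-t/m)) and refine the covering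
   from time t to t + s.
   If the first minimum at time t + s is not small, the short grid vector at
   that time is the same over each piece, and no subdivision is needed.
   Otherwise choose a rational subspace V of dimension k < d which contains all
   relevant short lattice vectors and for which covol(V) M^k is small. Each
   piece then splits into at most
     C e^(s k/d) (covol_(t+s)(V) / covol_t(V))^(n/d)
   pieces, with C independent of s. The covolumes telescope, so the number of
   pieces grows at most like e^((d-1)/d + o(1)) per unit of time spent in the
   cusp.
   The covolume of V is measured by the largest k x k minor of a basis of V. *)
Require Import Defs.
From mathcomp Require Import all_boot all_order all_algebra.
From mathcomp Require Import all_classical all_reals all_analysis.
From mathcomp Require Import ring lra.

Set Implicit Arguments.
Unset Strict Implicit.
Unset Printing Implicit Defensive.

Import Order.TTheory GRing.Theory Num.Theory.
Import numFieldNormedType.Exports.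

Local Open Scope ring_scope.

(** The induction carries a bound with the extra factor (covol_t(V) M^k)^(n/d), valid for all V at
    once; V = 0 has weight 1 and returns the plain count of pieces. M is chosen large in terms of
    the cusp threshold, so that outside the cusp Hermite's inequality makes every weight at least 1:
    there the bound for V = 0 implies all the others. In the cusp one may assume that the weight is
    at most 1, and this excludes k = d, because a sublattice of Z^d of full rank has covolume at
    least 1. This is where d - 1 comes from. Since C does not depend on s, taking s large makes its
    contribution (ln C)/s per unit of time negligible. Only then are the threshold, M and finally
    eps fixed, each in terms of the previous ones. A set is null as soon as each bound on the
    diameters admits one efficient covering, so good times along a sequence suffice: hence the lower
    escape of mass. *)

Section MaxMinor.
Variables (R : realFieldType) (D : nat).

Definition maxminor k (G : 'M[R]_(D, k)) : R :=
  \big[Num.max/0]_(f : {ffun 'I_k -> 'I_D}) `|\det (rowsub f G)|.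

Lemma maxminor_ge k (G : 'M[R]_(D, k)) (f : 'I_k -> 'I_D) :
  `|\det (rowsub f G)| <= maxminor G.
Proof.
have -> : rowsub f G = rowsub (finfun f) G.
  by apply/matrixP => i j; rewrite !mxE ffunE.
exact: (le_bigmax _ (fun f : {ffun _ -> _} => `|\det (rowsub f G)|)).
Qed.

Lemma maxminor_le k (G : 'M[R]_(D, k)) c : 0 <= c ->
  (forall f : 'I_k -> 'I_D, `|\det (rowsub f G)| <= c) -> maxminor G <= c.
Proof. by move=> c0 h; apply: bigmax_le => // f _; exact: h. Qed.

Lemma maxminor_ge0 k (G : 'M[R]_(D, k)) : 0 <= maxminor G.
Proof. by rewrite /maxminor; elim/big_ind: _ => // x y x0 y0; rewrite le_max x0. Qed.

Lemma maxminor_gt0P k (G : 'M[R]_(D, k)) :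
  reflect (exists f : 'I_k -> 'I_D, rowsub f G \in unitmx) (0 < maxminor G).
Proof.
apply: (iffP idP) => [|[f]]; last first.
  rewrite unitmxE unitfE => u; apply: lt_le_trans (maxminor_ge _ f).
  by rewrite normr_gt0.
case: (pselect (exists f : 'I_k -> 'I_D, rowsub f G \in unitmx)) => // h.
suff : maxminor G <= 0 by rewrite leNgt => /negP.
apply: maxminor_le => // f; rewrite normr_le0; apply/negPn/negP => n0.
by apply: h; exists f; rewrite unitmxE unitfE.
Qed.

Lemma maxminorM k (G : 'M[R]_(D, k)) (C : 'M[R]_k) :
  maxminor (G *m C) = maxminor G * `|\det C|.
Proof.
rewrite [LHS](_ : _ = \big[Num.max/0]_(f : {ffun 'I_k -> 'I_D})
  (`|\det (rowsub f G)| * `|\det C|)); last first.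
  by apply: eq_bigr => f _; rewrite -mul_rowsub_mx det_mulmx normrM.
rewrite /maxminor; elim/big_ind2: _ => //; first by rewrite mul0r.
by move=> x1 x2 y1 y2 -> ->; rewrite maxr_pMl.
Qed.

Lemma maxminorZ k (G : 'M[R]_(D, k)) a :
  maxminor (a *: G) = `|a| ^+ k * maxminor G.
Proof.
by rewrite -mul_mx_scalar maxminorM det_scalar normrX mulrC.
Qed.

Lemma maxminor0 (G : 'M[R]_(D, 0)) : maxminor G = 1.
Proof.
apply/eqP; rewrite eq_le; apply/andP; split.
  by apply: maxminor_le => // f; rewrite det_mx00 normr1.
have f0 : 'I_0 -> 'I_D by case.
by apply: le_trans (maxminor_ge G f0); rewrite det_mx00 normr1.
Qed.

Lemma maxminor_leq k (G : 'M[R]_(D, k)) : 0 < maxminor G -> (k <= D)%N.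
Proof.
move=> /maxminor_gt0P[f u]; rewrite -[k](mxrank_unit u).
by apply: leq_trans (rank_leq_row G); rewrite mxrankS ?rowsub_sub.
Qed.

Lemma maxminor_inj k (G : 'M[R]_(D, k)) p (c : 'M[R]_(k, p)) :
  0 < maxminor G -> G *m c = 0 -> c = 0.
Proof.
move=> /maxminor_gt0P[f u] Gc; apply: (can_inj (mulKmx u)).
by rewrite mul_rowsub_mx Gc mulmx0; apply/matrixP => i j; rewrite !mxE.
Qed.

(** Laplace expansion along the first column: there are k + 1 terms, and each cofactor is up to sign
    a minor of [G]. *)
Lemma maxminor_row_mx_le k (w : 'cV[R]_D) (G : 'M[R]_(D, k)) a : 0 <= a ->
  (forall i, `|w i 0| <= a) ->
  maxminor (row_mx w G : 'M[R]_(D, 1 + k)) <= k.+1%:R * a * maxminor G.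
Proof.
move=> a0 wa; apply: maxminor_le => [|f]; first by rewrite !mulr_ge0 ?maxminor_ge0.
rewrite (expand_det_col _ (ord0 : 'I_(1 + k))).
apply: le_trans (ler_norm_sum _ _ _) _.
rewrite (_ : k.+1%:R * a * maxminor G = \sum_(i < 1 + k) (a * maxminor G)); last first.
  by rewrite sumr_const card_ord -mulrA mulr_natl.
apply: ler_sum => i _; rewrite normrM ler_pM//.
  rewrite mxE -[ord0 : 'I_(1 + k)](lshift0 k 0) row_mxEl; exact: wa.
rewrite /cofactor normrM normrX normrN normr1 expr1n mul1r.
apply: le_trans (maxminor_ge G (f \o lift i)).
rewrite le_eqVlt; apply/orP; left; apply/eqP; congr (`| \det _ |).
apply/matrixP => a1 b1; rewrite !mxE.
have -> : lift ord0 b1 = rshift 1 b1 by apply: val_inj.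
by rewrite -[rshift 1 b1]/(unsplit (inr b1)) unsplitK.
Qed.

(** Adjoining row [r] to the rows of a minor of [G] gives a block triangular matrix, because [G]
    vanishes on that row. *)
Lemma maxminor_pivot k (w : 'cV[R]_D) (G : 'M[R]_(D, k)) r :
  row r G = 0 -> `|w r 0| * maxminor G <= maxminor (row_mx w G : 'M[R]_(D, 1 + k)).
Proof.
move=> rG; have [->|w0] := eqVneq (w r 0) 0.
  by rewrite normr0 mul0r maxminor_ge0.
rewrite mulrC -ler_pdivlMr ?normr_gt0//; apply: maxminor_le => [|f].
  by rewrite divr_ge0 ?maxminor_ge0.
rewrite ler_pdivlMr ?normr_gt0//.
pose f' (i : 'I_(1 + k)) := match fintype.split i with inl _ => r | inr j => f j end.
apply: le_trans (maxminor_ge _ f').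
have -> : rowsub f' (row_mx w G) = block_mx (w r 0)%:M 0 (rowsub f w) (rowsub f G).
  apply/matrixP => i j; rewrite !mxE /f'; case: (fintype.split i) => i'; rewrite !mxE;
    case: (fintype.split j) => j'; rewrite ?mxE ?(ord1 j') ?(ord1 i')//.
  by have /rowP/(_ j') := rG; rewrite !mxE.
by rewrite det_lblock det_scalar1 normrM mulrC.
Qed.

Lemma maxminor_shear k (w : 'cV[R]_D) (G : 'M[R]_(D, k)) (u : 'rV[R]_k) :
  maxminor (row_mx w (G + w *m u) : 'M[R]_(D, 1 + k)) = maxminor (row_mx w G : 'M[R]_(D, 1 + k)).
Proof.
have -> : row_mx w (G + w *m u) = row_mx w G *m block_mx 1%:M u 0 1%:M.
  by rewrite mul_row_block !mulmx1 mulmx0 addr0 addrC.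
by rewrite maxminorM det_ublock !det1 mulr1 normr1 mulr1.
Qed.

Lemma maxminor_shearl k (w : 'cV[R]_D) (G : 'M[R]_(D, k)) (c : 'cV[R]_k) :
  maxminor (row_mx (w + G *m c) G : 'M[R]_(D, 1 + k)) = maxminor (row_mx w G : 'M[R]_(D, 1 + k)).
Proof.
have -> : row_mx (w + G *m c) G = row_mx w G *m block_mx 1%:M 0 c 1%:M.
  by rewrite mul_row_block !mulmx1 mulmx0 add0r.
by rewrite maxminorM det_lblock !det1 mulr1 normr1 mulr1.
Qed.

Lemma row_shear_pivot k (w : 'cV[R]_D) (G : 'M[R]_(D, k)) r : w r 0 != 0 ->
  row r (G + w *m - ((w r 0)^-1 *: row r G)) = 0.
Proof.
move=> w0; apply/rowP => j; rewrite !mxE big_ord1 !mxE.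
by rewrite mulrN mulVKf// subrr.
Qed.

Lemma row_shear_mul k (w : 'cV[R]_D) (G : 'M[R]_(D, k)) r (a : R) (y : 'cV[R]_k) :
  row_mx w G *m col_mx (const_mx a : 'M[R]_1) y =
  (G + w *m - ((w r 0)^-1 *: row r G)) *m y +
  ((row r G *m y) 0 0 / w r 0 + a) *: w.
Proof.
rewrite mul_row_col mulmxDl -addrA addrC; congr (_ + _).
rewrite -mulmxA; apply/matrixP => i j; rewrite !mxE !big_ord1 !mxE.
set q := \sum_(_ < _) _; set q' := \sum_(_ < _) _.
have -> : q = - (q' / w r 0).
  rewrite /q' mulr_suml -sumrN; apply: eq_bigr => l _; rewrite !mxE (ord1 j).
  by ring.
by rewrite (ord1 j); ring.
Qed.

(** The coefficients solve the system on the rows of an invertible minor. A nonzero entry of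
    [w - G *m c] on any other row would produce a nonzero minor of size k + 1. *)
Lemma maxminor_span k (w : 'cV[R]_D) (G : 'M[R]_(D, k)) : 0 < maxminor G ->
  maxminor (row_mx w G : 'M[R]_(D, 1 + k)) = 0 -> exists c, w = G *m c.
Proof.
move=> /maxminor_gt0P[f u] h0.
exists (invmx (rowsub f G) *m rowsub f w).
set c := invmx _ *m _; apply/eqP; rewrite -subr_eq0; apply/eqP/colP => r.
rewrite !mxE; apply/eqP/negPn/negP => wr.
have e0 : rowsub f (w - G *m c) = 0.
  rewrite [LHS](_ : _ = rowsub f w - rowsub f (G *m c)); last first.
    by apply/matrixP => i j; rewrite !mxE.
  by rewrite -mul_rowsub_mx /c mulKVmx// subrr.
pose f' (i : 'I_(1 + k)) := match fintype.split i with inl _ => r | inr j => f j end.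
have : `|\det (rowsub f' (row_mx (w - G *m c) G : 'M[R]_(D, 1 + k)))| <= 0.
  by rewrite -h0 -(maxminor_shearl w G (- c)) mulmxN; exact: maxminor_ge.
rewrite normr_le0 => /eqP.
have -> : rowsub f' (row_mx (w - G *m c) G) =
    block_mx ((w - G *m c) r 0)%:M (row r G) 0 (rowsub f G).
  apply/matrixP => i j; rewrite !mxE /f'; case: (fintype.split i) => i'; rewrite !mxE;
    case: (fintype.split j) => j'; rewrite ?mxE ?(ord1 j') ?(ord1 i')//.
  by have /matrixP/(_ i' 0) := e0; rewrite !mxE.
rewrite det_ublock det_scalar1 => /eqP; rewrite mulf_eq0 !mxE (negbTE wr)/=.
by move: u; rewrite unitmxE unitfE => /negbTE ->.
Qed.

End MaxMinor.

(** * Hermite's inequality for minors *)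

Section ColumnNorm.
Variables (R : realType) (D : nat).
Implicit Types v : 'cV[R]_D.

Lemma cvnorm_ge v i : `|v i 0| <= `|v|.
Proof.
rewrite [leRHS]/Num.norm/= mx_normrE.
exact: (le_bigmax _ (fun ij => `|v ij.1 ij.2|) (i, 0)).
Qed.

Lemma cvnorm_le v a : 0 <= a -> (forall i, `|v i 0| <= a) -> `|v| <= a.
Proof.
move=> a0 h; rewrite [leLHS]/Num.norm/= mx_normrE.
by apply: bigmax_le => // -[i j] _ /=; rewrite (ord1 j).
Qed.

Lemma cvnorm_attained v : v != 0 -> exists i, `|v i 0| = `|v|.
Proof.
rewrite -normr_eq0 => /mx_norm_neq0[[i j]] /= e; exists i.
by rewrite [RHS]e (ord1 j).
Qed.

End ColumnNorm.

Section Hermite.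
Variables (R : realType) (D : nat).

Lemma intmxM p q r (A : 'M[int]_(p, q)) (B : 'M[int]_(q, r)) :
  intmx R (A *m B) = intmx R A *m intmx R B.
Proof. exact: map_mxM. Qed.

Lemma norm_det_unitmx_int k (L : 'M[int]_k) : L \in unitmx ->
  `|\det (intmx R L)| = 1.
Proof.
move=> uL; rewrite det_map_mx.
have /(congr1 (fun M => absz (\det M))) := mulmxV uL.
rewrite det_mulmx det1 abszM => /eqP; rewrite muln_eq1 => /andP[/eqP e _].
by rewrite -intr_norm -abszE e.
Qed.

(** The Smith form of a single column has one entry, so [z] is a multiple of a primitive vector,
    which is part of a basis of the integer lattice. *)
Lemma int_col_unimodular k (z : 'cV[int]_(1 + k)) : z != 0 ->
  exists (L : 'M[int]_(1 + k)) (t : int),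
    [/\ L \in unitmx, t != 0 & z = t *: lsubmx L].
Proof.
move=> z0; have [L uL [Q uQ [d _ e]]] := int_Smith_normal_form z.
pose t := d`_0 * Q 0 0.
have zt : z = t *: lsubmx L.
  rewrite e -mulmxA; set M := _ *m Q.
  have -> : M = t *: delta_mx 0 0.
    apply/matrixP => i j; rewrite !mxE (ord1 j) big_ord1 !mxE andbT /t.
    rewrite (_ : (i == 0) = (i == 0 :> nat))//.
    by case: eqP => [->|_]; rewrite ?mulr1n ?mulr1 ?mulr0n ?mul0r ?mulr0.
  rewrite -scalemxAr -colE; congr (_ *: _).
  by apply/matrixP => i j; rewrite !mxE (ord1 j) lshift0.
exists L, t; split=> //; apply: contra z0 => /eqP t0.
by rewrite zt t0 scale0r.
Qed.

(* Hermite's reduction: with [w] a nearly shortest lattice vector, the lattice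
   obtained by projecting along [w] onto a coordinate hyperplane has no vector
   much shorter than [w], since a lift can be corrected by a multiple of [w]
   to have [w]-component at most 1/2. *)
Lemma maxminor_lattice k (G : 'M[R]_(D, k)) (eta : R) : 0 < eta ->
  (forall z : 'cV[int]_k, z != 0 -> eta <= `|G *m intmx R z|) ->
  (4^-1) ^+ (k * k) * eta ^+ k <= maxminor G.
Proof.
elim: k G eta => [|k IH] G eta eta0 h.
  by rewrite maxminor0 !expr0 mul1r.
pose S := [set `|G *m intmx R z| | z in [set z : 'cV[int]_k.+1 | z != 0]]%classic.
have S0 : (S !=set0)%classic.
  exists `|G *m intmx R (delta_mx 0 0 : 'cV[int]_k.+1)|, (delta_mx 0 0) => //=.
  by apply/negP => /eqP/matrixP/(_ 0 0); rewrite !mxE.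
have etaS : lbound S eta by move=> _ [z /= z0 <-]; exact: h.
have iS : has_inf S by split=> //; exists eta.
pose sg := inf S.
have esg : eta <= sg by exact: lb_le_inf.
have sg0 : 0 < sg by exact: lt_le_trans esg.
have sgh (z : 'cV[int]_k.+1) : z != 0 -> sg <= `|G *m intmx R z|.
  by move=> z0; apply: ge_inf; [exists eta|exists z].
(* Attainment of the infimum is not established; a vector within a factor 3/2 is short enough. *)
have [_ [z1 /= z10 <-] z1s] : exists2 x, S x & x < sg + sg / 2.
  by apply: inf_adherent; rewrite // divr_gt0.
have [L [t [uL t0 zt]]] := int_col_unimodular z10.
pose GL := G *m intmx R L.
have GLG : maxminor GL = maxminor G by rewrite maxminorM norm_det_unitmx_int// mulr1.
pose w : 'cV[R]_D := lsubmx (GL : 'M[R]_(D, 1 + k)).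
pose G' : 'M[R]_(D, k) := rsubmx (GL : 'M[R]_(D, 1 + k)).
have wE : w = G *m intmx R (lsubmx (L : 'M[int]_(_, 1 + k))).
  rewrite (_ : intmx R _ = lsubmx (intmx R L : 'M[R]_(_, 1 + k))) ?mulmx_lsub//.
  by apply/matrixP => i j; rewrite !mxE.
have l0 : lsubmx (L : 'M[int]_(_, 1 + k)) != 0.
  by apply: contra z10 => /eqP l0; rewrite zt l0 scaler0.
have sgw : sg <= `|w| by rewrite wE; exact: sgh.
have wsg : `|w| < sg + sg / 2.
  apply: le_lt_trans z1s.
  have -> : intmx R z1 = t%:~R *: intmx R (lsubmx (L : 'M[int]_(_, 1 + k))).
    by apply/matrixP => i j; rewrite zt !mxE intrM.
  rewrite -scalemxAr -wE normrZ ler_peMl// -intr_norm ler1z -gtz0_ge1.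
  by rewrite normr_gt0.
have w0 : w != 0 by rewrite -normr_gt0; exact: lt_le_trans sgw.
have [r wr] := cvnorm_attained w0.
have wr0 : w r 0 != 0 by rewrite -normr_gt0 wr normr_gt0.
pose u := - ((w r 0)^-1 *: row r G').
pose G2 := G' + w *m u.
have rG2 : row r G2 = 0 by exact: row_shear_pivot.
(* A lift has norm at least [sg] and its [w] part at most 1/2 * 3/2 * [sg], which leaves [sg / 4]
   for the projected vector. The resulting factor 4^(-k) is absorbed when k * k grows to (k + 1) *
   (k + 1). *)
have G2b : (4^-1) ^+ (k * k) * (sg / 4) ^+ k <= maxminor G2.
  apply: IH; first by rewrite divr_gt0.
  move=> y y0.
  pose q := (row r G' *m intmx R y) 0 0 / w r 0.
  pose a := Num.floor (q + 2^-1).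
  have qa : `|q - a%:~R| <= 2^-1.
    have /andP[a1 a2] := floor_itv (q + 2^-1); rewrite -/a in a1 a2.
    by rewrite intrD in a2; rewrite ler_norml; apply/andP; split; lra.
  pose v := L *m col_mx (const_mx (- a) : 'M[int]_1) y.
  have v0 : v != 0.
    apply: contra y0 => /eqP v0; have : invmx L *m v = 0 by rewrite v0 mulmx0.
    rewrite mulKmx// => /(congr1 (@dsubmx _ 1 k 1)); rewrite col_mxKd => ->.
    by rewrite linear0.
  have vE : G *m intmx R v = G2 *m intmx R y + (q - a%:~R) *: w.
    rewrite intmxM mulmxA -/GL -[GL](@hsubmxK _ _ 1 k) -/w -/G'.
    have -> : intmx R (col_mx (const_mx (- a) : 'M[int]_1) y) =
        col_mx (const_mx (- a%:~R) : 'M[R]_1) (intmx R y).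
      by apply/matrixP => i j; rewrite !mxE; case: fintype.split => i'; rewrite !mxE// intrN.
    exact: row_shear_mul.
  have := sgh _ v0; rewrite vE => /le_trans/(_ (ler_normD _ _)).
  rewrite normrZ => hv.
  have : `|q - a%:~R| * `|w| <= 2^-1 * (sg + sg / 2).
    by rewrite ler_pM// ltW.
  by move: hv; lra.
rewrite -GLG -[GL](@hsubmxK _ _ 1 k) -/w -/G' -(maxminor_shear w G' u).
apply: le_trans (maxminor_pivot w rG2); rewrite wr.
apply: (@le_trans _ _ (sg * ((4^-1) ^+ (k * k) * (sg / 4) ^+ k))); last first.
  by rewrite ler_pM// ?mulr_ge0 ?exprn_ge0 ?divr_ge0 ?invr_ge0 ?ltW.
apply: (@le_trans _ _ ((4^-1) ^+ (k.+1 * k.+1) * sg ^+ k.+1)).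
  by rewrite ler_wpM2l ?exprn_ge0 ?invr_ge0// lerXn2r ?nnegrE// ltW.
rewrite exprMn exprS mulrCA ler_wpM2l ?(ltW sg0)//.
rewrite mulrCA mulrC ler_wpM2l ?exprn_ge0 ?(ltW sg0)// -exprD.
rewrite ler_wiXn2l ?invr_ge0 ?invf_le1 ?ler1n//.
by rewrite -mulSnr leq_mul.
Qed.

End Hermite.

(** * Coverings by sets of small diameter *)

Section Coverings.
Variables (R : realType) (m : nat).
Implicit Types (B : set 'cV[R]_m) (rho N : R).
Local Open Scope classical_set_scope.

(* A covering of [B] by at most [N] sets of diameter at most [rho], encoded by
   a labelling of the points whose fibres in [B] are the pieces. *)
Definition cov B rho N := exists (T : finType) (l : 'cV[R]_m -> T),
  #|T|%:R <= N /\ forall x y, B x -> B y -> l x = l y -> `|x - y| <= rho.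

Lemma cov_le B rho N N' : N <= N' -> cov B rho N -> cov B rho N'.
Proof. by move=> NN' [T [l [cT h]]]; exists T, l; split=> //; exact: le_trans NN'. Qed.

Lemma cov_refine B rho rho' N N' : 0 <= N' -> cov B rho N ->
  (forall U, U `<=` B -> (forall x y, U x -> U y -> `|x - y| <= rho) ->
    cov U rho' N') ->
  cov B rho' (N * N').
Proof.
move=> N'0 [T [l [cT h]]] hU.
have /choice[F hF] : forall t : T, exists F : {T' : finType & 'cV[R]_m -> T'},
    #|projT1 F|%:R <= N' /\
    forall x y, B x -> B y -> l x = t -> l y = t ->
      projT2 F x = projT2 F y -> `|x - y| <= rho'.
  move=> t; have [||T' [l' [cT' h']]] := hU (B `&` [set x | l x = t]).
  - by move=> x [].
  - by move=> x y [Bx xt] [By yt]; apply: h => //; rewrite xt yt.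
  - by exists (existT _ T' l'); split=> //= x y Bx By xt yt; exact: h'.
exists {t : T & projT1 (F t)}, (fun x => Tagged (fun t => projT1 (F t)) (projT2 (F (l x)) x)).
split.
  rewrite card_tagged sumnE big_map big_enum /=.
  apply: (@le_trans _ _ (#|T|%:R * N')); last by rewrite ler_wpM2r.
  rewrite natr_sum mulr_natl -sumr_const; apply: ler_sum => t _.
  by have [] := hF t.
move=> x y Bx By e; have [_ hlx] := hF (l x).
have lxy : l x = l y by exact: (congr1 (@tag _ _) e).
apply: hlx => //.
move: e; rewrite -lxy => e.
by move/eqP: e; rewrite (eq_Tagged (T_ := fun t => projT1 (F t))) => /eqP.
Qed.

Lemma itv_label (a eta : R) : 0 <= a -> 0 < eta ->
  exists (T : finType) (l : R -> T), #|T|%:R <= 2 * a / eta + 1 /\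
  forall x y, `|x| <= a -> `|y| <= a -> l x = l y -> `|x - y| <= eta.
Proof.
move=> a0 e0; set M := Num.truncn (2 * a / eta).
pose lab x := Num.truncn ((x + a) / eta).
exists 'I_M.+1, (fun x => inord (lab x)); split.
  by rewrite card_ord -natr1 lerD2r truncn_le divr_ge0 ?mulr_ge0// ltW.
have labM x : `|x| <= a -> (lab x < M.+1)%N.
  rewrite ler_norml ltnS => /andP[x1 x2]; apply: le_truncn.
  by rewrite ler_pM2r ?invr_gt0//; lra.
have labE x : `|x| <= a -> (lab x)%:R * eta <= x + a < (lab x)%:R * eta + eta.
  rewrite ler_norml => /andP[x1 x2].
  have /truncn_itv : 0 <= (x + a) / eta by rewrite divr_ge0 ?(ltW e0)//; lra.
  rewrite -/(lab x) -natr1 ler_pdivlMr// ltr_pdivrMr// => /andP[-> /=].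
  by rewrite mulrDl mul1r.
move=> x y xa ya /(congr1 val); rewrite /= !inordK ?labM// => lxy.
have /andP[x1 x2] := labE _ xa; have /andP[y1 y2] := labE _ ya.
rewrite lxy in x1 x2; rewrite ler_norml; apply/andP; split; lra.
Qed.

Lemma cov_box B (a eta : R) : 0 <= a -> 0 < eta ->
  (forall x, B x -> `|x| <= a) -> cov B eta ((2 * a / eta + 1) ^+ m).
Proof.
move=> a0 e0 Ba; have [T [l [cT h]]] := itv_label a0 e0.
exists {ffun 'I_m -> T}, (fun x => [ffun i => l (x i 0)]); split.
  rewrite card_ffun card_ord natrX lerXn2r ?nnegrE//.
  by rewrite addr_ge0// divr_ge0 ?mulr_ge0// ltW.
move=> x y /Ba xa /Ba ya /ffunP e.
apply: cvnorm_le; first exact: ltW.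
move=> i; have := e i; rewrite !ffunE !mxE => exy; apply: h => //.
- exact: le_trans (cvnorm_ge _ _) xa.
- exact: le_trans (cvnorm_ge _ _) ya.
Qed.

End Coverings.

(** * Refining a covering along a subspace *)

Section Pivot.
Variables (R : realFieldType) (D : nat).

Lemma col_unitmx k (c : 'cV[R]_(1 + k)) : c != 0 ->
  exists2 C : 'M[R]_(1 + k), C \in unitmx & lsubmx C = c.
Proof.
move=> c0; pose U : 'rV[R]_(1 + k) := delta_mx 0 0.
have UU : U *m (U^T *m c^T) = c^T.
  by rewrite mulmxA trmx_delta mul_delta_mx -rowE row_id.
have [|g ug] := @complete_unitmx _ _ _ U (U^T *m c^T).
  rewrite UU !rank_rV -(inj_eq (@trmx_inj _ _ _)) trmxK trmx0 c0.
  case: eqP => // /matrixP/(_ 0 0); rewrite !mxE => /eqP.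
  by rewrite oner_eq0.
rewrite UU -rowE => cg; exists g^T; first by rewrite unitmx_tr.
apply/colP => i; have /rowP/(_ i) := cg; rewrite !mxE => ->.
by congr (g _ _); apply: val_inj.
Qed.

(** The projection along the first column onto the hyperplane where coordinate [r] vanishes, applied
    to the remaining columns. *)
Definition schur k (G : 'M[R]_(D, 1 + k)) r : 'M[R]_(D, k) :=
  rsubmx G + lsubmx G *m - ((lsubmx G r 0)^-1 *: row r (rsubmx G)).

Variables (k : nat) (G : 'M[R]_(D, 1 + k)) (r : 'I_D).
Hypothesis Gr0 : lsubmx G r 0 != 0.

Lemma row_schur : row r (schur G r) = 0.
Proof. exact: row_shear_pivot. Qed.

Lemma schur_mul a (y : 'cV[R]_k) : exists a',
  G *m col_mx (const_mx a : 'M[R]_1) y = schur G r *m y + a' *: lsubmx G.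
Proof. by rewrite -{1}[G]hsubmxK (row_shear_mul _ _ r); eexists. Qed.

Lemma schur_proj (c : 'cV[R]_(1 + k)) :
  schur G r *m dsubmx c =
  G *m c - ((G *m c) r 0 / lsubmx G r 0) *: lsubmx G.
Proof.
have [a' e] : exists a', G *m c = schur G r *m dsubmx c + a' *: lsubmx G.
  have [a' e] := schur_mul (c (lshift k 0) 0) (dsubmx c); exists a'.
  rewrite -e; congr (_ *m _); rewrite -{1}[c]vsubmxK; congr col_mx.
  by apply/matrixP => i j; rewrite !mxE (ord1 i) (ord1 j).
have e2 : (schur G r *m dsubmx c) r 0 = 0.
  have : row r (schur G r *m dsubmx c) = 0 by rewrite row_mul row_schur mul0mx.
  by move=> /rowP/(_ 0); rewrite !mxE.
rewrite e; have -> : (schur G r *m dsubmx c + a' *: lsubmx G) r 0 = a' * lsubmx G r 0.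
  by rewrite mxE e2 add0r mxE.
by rewrite mulfK// addrK.
Qed.

Lemma maxminor_schur_le a : 0 <= a -> (forall i, `|lsubmx G i 0| <= a) ->
  maxminor G <= k.+1%:R * a * maxminor (schur G r).
Proof.
move=> a0 wa; rewrite -{1}[G]hsubmxK.
by rewrite -(maxminor_shear _ _ (- ((lsubmx G r 0)^-1 *: row r (rsubmx G)))) maxminor_row_mx_le.
Qed.

Lemma maxminor_schur_ge (M : 'M[R]_D) : row r (M *m schur G r) = 0 ->
  `|(M *m lsubmx G) r 0| * maxminor (M *m schur G r) <= maxminor (M *m G).
Proof.
move=> h; apply: le_trans (maxminor_pivot _ h) _.
rewrite -[X in _ <= maxminor (_ *m X)]hsubmxK mul_mx_row /schur mulmxDr mulmxA.
by rewrite maxminor_shear.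
Qed.

End Pivot.

Section ExpandX.
Variables (R : realType) (m n : nat).

(** Up to a scalar this is the flow over a time s, with lam = e^(s(1/m + 1/n)); see [flow_scale]. *)
Definition expandx (lam : R) : 'M[R]_(m + n) := block_mx lam%:M 0 0 1%:M.

Lemma expandxE k lam (G : 'M[R]_(m + n, k)) :
  expandx lam *m G = col_mx (lam *: usubmx G) (dsubmx G).
Proof.
rewrite -{1}[G]vsubmxK mul_block_col !mul0mx addr0 add0r mul1mx.
by rewrite mul_scalar_mx.
Qed.

Lemma expandx_row0 k lam (G : 'M[R]_(m + n, k)) r :
  row r G = 0 -> row r (expandx lam *m G) = 0.
Proof.
move=> /rowP h; apply/rowP => j; have := h j; rewrite expandxE !mxE.
by case: split_ordP => i e; rewrite !mxE -e => ->; rewrite ?mulr0.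
Qed.

Lemma cv_entry_le (v : 'cV[R]_(m + n)) a : `|usubmx v| <= a -> `|dsubmx v| <= a ->
  forall i, `|v i 0| <= a.
Proof.
move=> hu hd i; rewrite -[v]vsubmxK; case: (split_ordP i) => j ->.
  by rewrite col_mxEu; apply: le_trans (cvnorm_ge _ _) hu.
by rewrite col_mxEd; apply: le_trans (cvnorm_ge _ _) hd.
Qed.

(** Bounds the quotient of minors from below, so that a covering by boundedly many pieces is within
    the allowed count. The columns are eliminated one by one with a pivot among the y coordinates,
    which [expandx] fixes; the elimination costs k + 1 at each stage, hence k!. *)
Lemma expandx_maxminor_steep k lam (G : 'M[R]_(m + n, k)) : 1 <= lam ->
  0 < maxminor G ->
  (forall c, lam * `|usubmx (G *m c : 'cV[R]_(m + n))| <= `|dsubmx (G *m c : 'cV[R]_(m + n))|) ->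
  maxminor G <= k`!%:R * maxminor (expandx lam *m G).
Proof.
move=> lam1; elim: k G => [|k IH] G G0 h; first by rewrite !maxminor0 mulr1.
set w : 'cV[R]_(m + n) := lsubmx (G : 'M[R]_(_, 1 + k)).
have wE : w = G *m (delta_mx 0 0 : 'cV[R]_k.+1).
  by rewrite -colE; apply/matrixP => i j; rewrite !mxE; congr (G _ _);
    apply: val_inj; rewrite (ord1 j).
have w0 : w != 0.
  apply/eqP => w0; move: wE; rewrite w0 => /esym/(maxminor_inj G0)/matrixP/(_ 0 0).
  by rewrite !mxE !eqxx /= => /eqP; rewrite oner_eq0.
have hw : `|usubmx w| <= `|dsubmx w|.
  by apply: le_trans (_ : lam * `|usubmx w| <= _); rewrite ?ler_peMl// wE h.
have d0 : dsubmx w != 0.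
  apply: contra w0 => /eqP d0; move: hw; rewrite d0 normr0 normr_le0 => /eqP u0.
  by rewrite -[w]vsubmxK u0 d0 col_mx0.
have [r' r'w] := cvnorm_attained d0.
pose r := rshift m r'.
have wr : `|w r 0| = `|dsubmx w| by rewrite -r'w [in RHS]mxE.
have wr0 : w r 0 != 0 by rewrite -normr_gt0 wr normr_gt0.
have le1 := maxminor_schur_le r (normr_ge0 (dsubmx w)) (cv_entry_le hw (lexx _)).
set G2 := schur _ _ in le1.
have G20 : 0 < maxminor G2.
  rewrite lt_neqAle maxminor_ge0 andbT; apply/eqP => e.
  by move: le1; rewrite -e mulr0 leNgt G0.
have IH2 : maxminor G2 <= k`!%:R * maxminor (expandx lam *m G2).
  apply: IH => // c; pose c' : 'cV[R]_(1 + k) := col_mx 0 c.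
  have := schur_proj wr0 c'; rewrite /c' col_mxKd => ->.
  rewrite -/w wE scalemxAr -mulmxBr; exact: h.
have le2 := @maxminor_schur_ge _ _ _ G r (expandx lam) (expandx_row0 lam (row_schur wr0)).
apply: (le_trans le1); rewrite factS natrM -!mulrA ler_pM2l ?ltr0n//.
apply: le_trans (_ : `|dsubmx w| * (k`!%:R * maxminor (expandx lam *m G2)) <= _).
  by rewrite ler_pM2l ?normr_gt0.
rewrite mulrCA ler_pM2l ?ltr0n ?fact_gt0//; apply: le_trans le2.
by rewrite ler_wpM2r ?maxminor_ge0// -/w -r'w expandxE /r col_mxEd.
Qed.

End ExpandX.

(** * Slopes of the column space and the steep case *)

Section CoverStep.
Variables (R : realType) (m n : nat) (alpha : R).
Hypotheses (alpha0 : 0 <= alpha) (alpha1 : alpha <= 1).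
Local Notation xpart v := (usubmx (v : 'cV[R]_(m + n))).
Local Notation ypart v := (dsubmx (v : 'cV[R]_(m + n))).

(** [c] maximises the x part over the unit box up to a factor 2, which replaces a compactness
    argument. Rescaling [c'] to the boundary of the box compares the slopes when the y part
    dominates; if the x part dominates, the rescaled x part is 1 and the second alternative
    holds. *)
Lemma near_max_slope k (G : 'M[R]_(m + n, k)) lam c0 : 1 <= lam ->
  `|ypart (G *m c0)| < lam * `|xpart (G *m c0)| ->
  exists c, [/\ lam^-1 <= `|xpart (G *m c)| <= 1, `|ypart (G *m c)| <= 1 &
    forall c', `|xpart (G *m c')| <= 2 * `|xpart (G *m c)| * `|ypart (G *m c')| \/
      1 <= 2 * `|xpart (G *m c)|].
Proof.
move=> lam1 hc0; have lam0 : 0 < lam by exact: lt_le_trans lam1.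
have scE a (c : 'cV[R]_k) : `|xpart (G *m (a *: c))| = `|a| * `|xpart (G *m c)| /\
    `|ypart (G *m (a *: c))| = `|a| * `|ypart (G *m c)|.
  by rewrite -scalemxAr !linearZ /= !normrZ.
pose S := [set `|xpart (G *m c)| | c in
  [set c : 'cV[R]_k | `|xpart (G *m c)| <= 1 /\ `|ypart (G *m c)| <= 1]]%classic.
have x0 : 0 < `|xpart (G *m c0)|.
  by rewrite -(pmulr_rgt0 _ lam0); apply: le_lt_trans hc0.
have ubS : has_ubound S by exists 1 => _ [c [h _] <-].
have [c1 [Sc1x Sc1y c1l]] : exists c1, [/\ `|xpart (G *m c1)| <= 1,
    `|ypart (G *m c1)| <= 1 & lam^-1 <= `|xpart (G *m c1)|].
  have [xy|yx] := leP `|ypart (G *m c0)| `|xpart (G *m c0)|.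
    exists (`|xpart (G *m c0)|^-1 *: c0).
    have [-> ->] := scE `|xpart (G *m c0)|^-1 c0.
    rewrite normfV normr_id mulVf ?gt_eqF// invf_le1//; split=> //.
    by rewrite mulrC ler_pdivrMr// mul1r.
  have y0 : 0 < `|ypart (G *m c0)| by exact: lt_trans yx.
  exists (`|ypart (G *m c0)|^-1 *: c0).
  have [-> ->] := scE `|ypart (G *m c0)|^-1 c0.
  rewrite normfV normr_id mulVf ?gt_eqF//; split=> //.
    by rewrite mulrC ler_pdivrMr// mul1r ltW.
  by rewrite mulrC ler_pdivlMr// mulrC ler_pdivrMr// mulrC ltW.
have [c [Scx Scy cl ch]] : exists c, [/\ `|xpart (G *m c)| <= 1,
    `|ypart (G *m c)| <= 1, lam^-1 <= `|xpart (G *m c)| &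
    sup S <= 2 * `|xpart (G *m c)|].
  have Sc1 : S `|xpart (G *m c1)| by exists c1.
  have s0 : 0 < sup S.
    by apply: lt_le_trans (ub_le_sup ubS Sc1); apply: lt_le_trans c1l; rewrite invr_gt0.
  have [h|h] := leP (sup S) (2 * `|xpart (G *m c1)|); first by exists c1.
  have s2 : 0 < sup S / 2 by rewrite divr_gt0.
  have hs : has_sup S by split=> //; exists `|xpart (G *m c1)|.
  have [_ [c [h1 h2] <-] hc] := sup_adherent s2 hs.
  exists c; split=> //; last by lra.
  apply: (le_trans c1l); lra.
exists c; split; rewrite ?cl ?Scx// => c'.
have [h|h] := leP 1 (2 * `|xpart (G *m c)|); [by right|left].
have P c2 : `|xpart (G *m c2)| <= 1 -> `|ypart (G *m c2)| <= 1 ->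
    `|xpart (G *m c2)| <= 2 * `|xpart (G *m c)|.
  by move=> ? ?; apply: le_trans ch; apply: ub_le_sup => //; exists c2.
have [xy|yx] := leP `|xpart (G *m c')| `|ypart (G *m c')|.
  have [y0|y0] := eqVneq `|ypart (G *m c')| 0; first by rewrite y0 mulr0 -y0.
  have y1 : 0 < `|ypart (G *m c')| by rewrite lt_neqAle eq_sym y0 normr_ge0.
  have := P (`|ypart (G *m c')|^-1 *: c').
  have [-> ->] := scE `|ypart (G *m c')|^-1 c'.
  rewrite normfV normr_id mulVf// => /(_ _ (lexx _)).
  by rewrite mulrC !ler_pdivrMr// mul1r; apply.
have x1 : 0 < `|xpart (G *m c')| by exact: le_lt_trans yx.
have := P (`|xpart (G *m c')|^-1 *: c').
have [-> ->] := scE `|xpart (G *m c')|^-1 c'.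
rewrite normfV normr_id mulVf ?gt_eqF// => /(_ (lexx _)).
rewrite mulrC ler_pdivrMr// mul1r => /(_ (ltW yx)).
by rewrite leNgt h.
Qed.

(* [theta] stands for e^(-tau (1/m + 1/n)) with 0 <= tau <= s, and [alpha] for
   n/d, so that theta^alpha = e^(-tau/m) and theta^(alpha - 1) = e^(tau/n): at
   each intermediate time [tau] some vector of the column space of [G], shifted
   by [b] and moved by the flow, has norm at most [a]. *)
Definition shadow k (G : 'M[R]_(m + n, k)) (lam a : R) (B : set 'cV[R]_m) :=
  forall b, B b -> `|b| <= a /\ forall th, lam^-1 <= th -> th <= 1 ->
    exists c, `|xpart (G *m c) - b| <= a * th `^ alpha /\
      `|ypart (G *m c)| <= a * th `^ (alpha - 1).

Lemma mulr_powRB1_gt0 (th : R) : 0 < th -> th * th `^ (alpha - 1) = th `^ alpha.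
Proof.
move=> th0; rewrite -{1}(powRr1 (ltW th0)) -powRD ?(gt_eqF th0) ?implybT//.
by rewrite addrC subrK.
Qed.

Lemma powRB1_ge1 (th : R) : 0 < th -> th <= 1 -> 1 <= th `^ (alpha - 1).
Proof.
move=> th0 th1; rewrite -[leLHS](powRr0 th); apply: ger_powR; first by rewrite th0.
by rewrite subr_le0.
Qed.

Lemma powR_inv (lam : R) : 0 <= lam -> (lam^-1) `^ alpha = lam `^ (- alpha).
Proof. by move=> l0; rewrite -powR_inv1// -powRrM mulN1r. Qed.

(** At the final time [th = lam^-1] the y part is at most a lam^(1 - alpha). Steepness bounds the x
    part by a lam^(-alpha), so all of [B] lies in a ball of radius 2 a lam^(-alpha), of the target
    size. *)
Lemma cov_steep k (G : 'M[R]_(m + n, k)) lam a B eta : 0 < eta -> 1 <= lam ->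
  0 < a -> 0 < maxminor G -> shadow G lam a B ->
  (forall c, lam * `|xpart (G *m c)| <= `|ypart (G *m c)|) ->
  cov B (eta * (a * lam `^ (- alpha))) ((k`!%:R * (4 / eta + 1) ^+ m) *
    (maxminor (expandx m n lam *m G) / maxminor G) `^ alpha).
Proof.
move=> eta0 lam1 a0 G0 sh st; have lam0 : 0 < lam by exact: lt_le_trans lam1.
have p0 : 0 < lam `^ (- alpha) by rewrite powR_gt0.
have hB b : B b -> `|b| <= 2 * (a * lam `^ (- alpha)).
  move=> /sh[_ /(_ lam^-1 (lexx _))][|c [h1 h2]]; first by rewrite invf_le1.
  have := st c; rewrite mulrC -ler_pdivlMr// => h3.
  rewrite -powR_inv ?(ltW lam0)//.
  have h4 : `|ypart (G *m c)| / lam <= a * lam^-1 `^ alpha.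
    rewrite -(@mulr_powRB1_gt0 lam^-1) ?invr_gt0// mulrCA mulrC.
    by rewrite ler_pM2l ?invr_gt0.
  have -> : b = xpart (G *m c) - (xpart (G *m c) - b) by rewrite opprB addrC subrK.
  apply: le_trans (ler_normB _ _) _; lra.
apply: cov_le (cov_box (a := 2 * (a * lam `^ (- alpha))) _ _ hB); last 2 first.
- by rewrite !mulr_ge0// ltW.
- by rewrite !mulr_gt0.
rewrite (_ : 2 * _ / _ = 4 / eta); last first.
  by field; rewrite !gt_eqF.
set ratio := maxminor _ / maxminor _.
have hr : 1 <= k`!%:R * ratio.
  by rewrite mulrA ler_pdivlMr// mul1r; exact: (expandx_maxminor_steep lam1 G0 st).
have f1 : 1 <= k`!%:R :> R by rewrite ler1n fact_gt0.
have f0 : 0 < k`!%:R :> R by exact: lt_le_trans f1.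
have r0 : 0 <= ratio by rewrite divr_ge0 ?maxminor_ge0.
rewrite mulrAC ler_peMl//.
  by rewrite exprn_ge0// addr_ge0// divr_ge0// ltW.
apply: (@le_trans _ _ ((k`!%:R * ratio) `^ alpha)).
  by rewrite -[leLHS](powRr0 (k`!%:R * ratio)); apply: ler_powR.
by rewrite powRM ?(ltW f0)// ler_wpM2r ?powR_ge0// ler1_powR.
Qed.

End CoverStep.

Section CoverStepInduction.
Variables (R : realType) (m n : nat) (alpha : R).
Hypotheses (alpha0 : 0 <= alpha) (alpha1 : alpha <= 1).
Local Notation xpart v := (usubmx (v : 'cV[R]_(m + n))).
Local Notation ypart v := (dsubmx (v : 'cV[R]_(m + n))).

Section PivotStep.
Variables (k : nat) (G : 'M[R]_(m + n, 1 + k)) (lam a : R) (B : set 'cV[R]_m).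
Variable r1 : 'I_m.
Hypotheses (lam1 : 1 <= lam) (a0 : 0 < a) (G0 : 0 < maxminor G).
Local Notation w := (lsubmx G).
Local Notation r := (lshift n r1).
Let kap : R := `|w r 0|.
Hypotheses (wx : `|xpart w| = kap) (wy : `|ypart w| <= 1).
Hypotheses (kap1 : lam^-1 <= kap <= 1).
Hypothesis slope : forall c, `|xpart (G *m c)| <= 2 * kap * `|ypart (G *m c)| \/
  1 <= 2 * kap.
Hypothesis shB : shadow alpha G lam a B.

Let lam0 : 0 < lam. Proof. exact: lt_le_trans lam1. Qed.
Let kap0 : 0 < kap.
Proof. by case/andP: kap1 => h _; apply: lt_le_trans h; rewrite invr_gt0. Qed.
Let wr0 : w r 0 != 0. Proof. by rewrite -normr_gt0. Qed.

(** The elimination of [schur], carried out on the shifts [b]. This is possible since the pivot is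
    an x coordinate. *)
Definition pivot_proj (b : 'cV[R]_m) := b - (b r1 0 / w r 0) *: xpart w.

Lemma pivot_proj_le b : `|pivot_proj b| <= 2 * `|b|.
Proof.
apply: (le_trans (ler_normB _ _)); rewrite normrZ wx normf_div -/kap.
rewrite divfK ?(gt_eqF kap0)// mulr_natl mulr2n lerD2l.
exact: cvnorm_ge.
Qed.

(** Projecting at most doubles the x error. In the y part, subtracting the multiple of [w] adds at
    most |x part| / kap, which is at most 4 a th^(alpha - 1) in either case of [slope]; with the
    original y part this gives the constant 5. *)
Lemma shadow_pivot :
  shadow alpha (schur G r) lam (5 * a) [set pivot_proj b | b in B]%classic.
Proof.
move=> _ [b Bb <-]; have [ba hb] := shB Bb; split.
  by apply: le_trans (pivot_proj_le b) _; move: (a0) ba; lra.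
move=> th th1 th2; have [c [h1 h2]] := hb _ th1 th2.
have th0 : 0 < th by apply: lt_le_trans th1; rewrite invr_gt0.
have tha0 : 0 < th `^ alpha by rewrite powR_gt0.
have tha1 : th `^ alpha <= 1.
  by rewrite -[leRHS](powRr0 th); apply: ger_powR; rewrite ?th0.
have thb := powRB1_ge1 alpha1 th0 th2.
set v := G *m c in h1 h2.
have vr : v r 0 = xpart v r1 0 by rewrite [RHS]mxE.
exists (dsubmx c); rewrite schur_proj// -/v; split.
  have -> : xpart (v - (v r 0 / w r 0) *: w) - pivot_proj b = pivot_proj (xpart v - b).
    rewrite /pivot_proj vr linearB linearZ /=.
    by apply/colP => i; rewrite !mxE; ring.
  apply: le_trans (pivot_proj_le _) _.
  have : 0 < a * th `^ alpha by rewrite mulr_gt0.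
  lra.
rewrite linearB linearZ /=; apply: (le_trans (ler_normB _ _)).
rewrite normrZ normf_div -/kap.
have vrx : `|v r 0| <= `|xpart v| by rewrite vr cvnorm_ge.
have hx : `|xpart v| / kap <= 4 * (a * th `^ (alpha - 1)).
  rewrite ler_pdivrMr//; have [h|h] := slope c.
    have : kap * `|ypart v| <= kap * (a * th `^ (alpha - 1)) by rewrite ler_pM2l.
    have : 0 < kap * (a * th `^ (alpha - 1)) by rewrite !mulr_gt0// powR_gt0.
    by rewrite -/v in h; lra.
  have hv : `|xpart v| <= 2 * a.
    have -> : xpart v = (xpart v - b) + b by rewrite subrK.
    apply: le_trans (ler_normD _ _) _.
    have : a * th `^ alpha <= a by rewrite ler_piMr// ltW.
    lra.
  have : 1 <= 2 * kap * th `^ (alpha - 1) by rewrite mulr_ege1.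
  by move=> /(ler_wpM2l (ltW a0)); lra.
have : `|v r 0| / kap * `|ypart w| <= `|xpart v| / kap.
  rewrite -[leRHS]mulr1; apply: ler_pM => //.
    by rewrite divr_ge0 ?(ltW kap0).
  by rewrite ler_pM2r ?invr_gt0.
by move: hx; lra.
Qed.

(** At [th = kap] the two bounds balance: kap times the y bound a th^(alpha - 1) equals the x error
    a th^alpha. One such term and twice the other give the constant 3. *)
Lemma pivot_coord b : B b -> `|b r1 0| <= 3 * (a * kap `^ alpha).
Proof.
move=> Bb; have [ba hb] := shB Bb; case/andP: (kap1) => k1 k2.
have [c [h1 h2]] := hb _ k1 k2; set v := G *m c in h1 h2.
have p0 : 0 < a * kap `^ alpha by rewrite mulr_gt0// powR_gt0.
apply: (le_trans (cvnorm_ge _ _)); have [h|h] := slope c.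
  have -> : b = xpart v - (xpart v - b) by rewrite opprB addrC subrK.
  apply: (le_trans (ler_normB _ _)); rewrite -/v in h.
  have : kap * `|ypart v| <= a * kap `^ alpha.
    by rewrite -mulr_powRB1_gt0// mulrCA ler_pM2l.
  lra.
have : kap <= kap `^ alpha by rewrite ger1_powR// kap0.
by move=> /(ler_wpM2l (ltW a0)) => h3; move: h => /(ler_wpM2l (ltW a0)) h; lra.
Qed.

(** After the expansion the pivot entry of [w] is lam kap, so the numerator loses at least this
    factor; the entries of [w] are at most 1, so the denominator loses at most k + 1. *)
Lemma pivot_ratio : 0 < maxminor (schur G r) /\
  lam * kap * (maxminor (expandx m n lam *m schur G r) / maxminor (schur G r)) <=
  k.+1%:R * (maxminor (expandx m n lam *m G) / maxminor G).
Proof.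
have we : forall i, `|w i 0| <= 1.
  by case/andP: (kap1) => _ k2; apply: cv_entry_le; rewrite // wx.
have le1 := maxminor_schur_le r ler01 we; rewrite mulr1 in le1.
have s0 : 0 < maxminor (schur G r).
  rewrite lt_neqAle maxminor_ge0 andbT; apply/eqP => e.
  by move: le1; rewrite -e mulr0 leNgt G0.
split=> //.
have le2 := @maxminor_schur_ge _ _ _ G r (expandx m n lam) (expandx_row0 lam (row_schur wr0)).
rewrite [leLHS]mulrA [leRHS]mulrCA; apply: ler_pM.
- by rewrite !mulr_ge0 ?maxminor_ge0// ltW.
- by rewrite invr_ge0 ltW.
- apply: le_trans le2; rewrite ler_wpM2r ?maxminor_ge0// expandxE col_mxEu.
  rewrite mxE normrM (gtr0_norm lam0).
  by rewrite /kap [in leRHS]mxE.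
- by rewrite ler_pdivlMr// mulrC ler_pdivrMr.
Qed.

(** A point is recovered from its projection and its pivot coordinate, and each of the two gets half
    of the allowed diameter: eta/10 * 5a is one half, an interval of length [eta / 2] in units of a
    lam^(-alpha) the other. *)
Lemma cov_pivot eta N : 0 < eta -> 0 <= N ->
  cov [set pivot_proj b | b in B]%classic (eta / 10 * (5 * a * lam `^ (- alpha))) N ->
  cov B (eta * (a * lam `^ (- alpha))) (N * ((12 / eta + 1) * (lam * kap) `^ alpha)).
Proof.
move=> eta0 N0 [T2 [l2 [c2 h2]]].
have p0 : 0 < lam `^ (- alpha) by rewrite powR_gt0.
have k0 : 0 < kap `^ alpha by rewrite powR_gt0.
have e0 : 0 < eta / 2 * (a * lam `^ (- alpha)) by rewrite !mulr_gt0// invr_gt0.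
have [|T1 [l1 [c1 h1]]] := @itv_label R (3 * (a * kap `^ alpha)) _ _ e0.
  by rewrite !mulr_ge0// ltW.
exists (T2 * T1)%type, (fun b => (l2 (pivot_proj b), l1 (b r1 0))); split.
  rewrite card_prod natrM; apply: ler_pM => //; apply: (le_trans c1).
  have -> : 2 * (3 * (a * kap `^ alpha)) / (eta / 2 * (a * lam `^ (- alpha))) =
      12 / eta * (lam * kap) `^ alpha.
    rewrite powRM ?(ltW lam0) ?(ltW kap0)// powRN.
    by field; rewrite !gt_eqF// powR_gt0.
  (* The additional piece from rounding is absorbed because lam kap is at least 1. *)
  rewrite [leRHS]mulrDl lerD2l mul1r -[leLHS](powRr0 (lam * kap)); apply: ler_powR => //.
  by case/andP: kap1 => h _; rewrite mulrC -ler_pdivrMr// div1r.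
move=> x y Bx By [e1 e2].
have d2 := h2 _ _ (imageP pivot_proj Bx) (imageP pivot_proj By) e1.
have d1 := h1 _ _ (pivot_coord Bx) (pivot_coord By) e2.
have -> : x - y = (pivot_proj x - pivot_proj y) + ((x r1 0 - y r1 0) / w r 0) *: xpart w.
  rewrite /pivot_proj mulrBl scalerBl; move: (_ *: _) (_ *: _) => u u'.
  by apply/colP => i; rewrite !mxE; ring.
apply: (le_trans (ler_normD _ _)); rewrite normrZ wx normf_div -/kap.
rewrite divfK ?(gt_eqF kap0)//.
apply: le_trans (lerD d2 d1) _.
by rewrite le_eqVlt; apply/orP; left; apply/eqP; field.
Qed.

End PivotStep.

(* Induction on the dimension. If every vector of the column space is steep, one
   ball suffices. Otherwise take [w] of almost maximal slope [kap]: the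
   condition at [theta = kap] confines one coordinate of the points to an
   interval of length O(a kap^alpha), which costs a factor (lam kap)^alpha;
   projecting along [w] lowers the dimension by one and the quotient of minors
   by a factor [lam * kap]. *)
Lemma cov_step k (eta : R) : 0 < eta -> exists2 C : R, 0 < C &
  forall (G : 'M[R]_(m + n, k)) (lam a : R) (B : set 'cV[R]_m), 1 <= lam ->
    0 < a -> 0 < maxminor G ->
    shadow alpha G lam a B ->
    cov B (eta * (a * lam `^ (- alpha)))
      (C * (maxminor (expandx m n lam *m G) / maxminor G) `^ alpha).
Proof.
elim: k eta => [|k IH] eta eta0.
  exists (0`!%:R * (4 / eta + 1) ^+ m).
    by rewrite mulr_gt0// exprn_gt0// addr_gt0// divr_gt0.
  move=> G lam a B lam1 a0 G0 sh; apply: cov_steep => // c.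
  by rewrite (flatmx0 c) mulmx0 !linear0 !normr0 mulr0.
have [|C C0 hC] := IH (eta / 10); first by rewrite divr_gt0.
set C1 := k.+1`!%:R * (4 / eta + 1) ^+ m.
set C2 := C * (12 / eta + 1) * k.+1%:R.
have C10 : 0 < C1.
  by rewrite mulr_gt0 ?ltr0n ?fact_gt0// exprn_gt0// addr_gt0// divr_gt0.
have C20 : 0 < C2 by rewrite !mulr_gt0// addr_gt0// divr_gt0.
exists (C1 + C2); first by rewrite addr_gt0.
move=> G lam a B lam1 a0 G0 sh.
have [st|nst] := pselect (forall c, lam * `|xpart (G *m c)| <= `|ypart (G *m c)|).
  apply: cov_le (cov_steep alpha0 alpha1 eta0 lam1 a0 G0 sh st).
  by rewrite ler_wpM2r ?powR_ge0// lerDl ltW.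
have [c0 hc0] : exists c0, `|ypart (G *m c0)| < lam * `|xpart (G *m c0)|.
  apply: contrapT => h; apply: nst => c; rewrite leNgt; apply/negP => h'.
  by apply: h; exists c.
have [c [/andP[k1 k2] cy slope]] := near_max_slope lam1 hc0.
have lam0 : 0 < lam by exact: lt_le_trans lam1.
have kap0 : 0 < `|xpart (G *m c)| by apply: lt_le_trans k1; rewrite invr_gt0.
have c_neq0 : c != 0.
  by apply/eqP => c0'; move: kap0; rewrite c0' mulmx0 linear0 normr0 ltxx.
(* A change of basis makes the near-maximal vector the first column; numerator and denominator of
   the quotient of minors both change by |det Q|. *)
have [Q uQ Qc] := col_unitmx (c_neq0 : (c : 'cV_(1 + k)) != 0).
pose GQ : 'M[R]_(m + n, 1 + k) := G *m Q.
have wE : lsubmx GQ = G *m c by rewrite /GQ -mulmx_lsub Qc.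
have xw0 : xpart (lsubmx GQ) != 0 by rewrite wE -normr_gt0.
have [r1 hr1] := cvnorm_attained xw0.
have kapE : `|lsubmx GQ (lshift n r1) 0| = `|xpart (G *m c)|.
  by rewrite -wE -hr1 [in RHS]mxE.
have dQ : `|\det Q| != 0 by rewrite normr_eq0; move: uQ; rewrite unitmxE unitfE.
have mQ (M : 'M[R]_(m + n)) : maxminor (M *m GQ) = maxminor (M *m G) * `|\det Q|.
  by rewrite /GQ mulmxA maxminorM.
have GQ0 : 0 < maxminor GQ.
  by rewrite /GQ maxminorM mulr_gt0// lt_neqAle eq_sym dQ normr_ge0.
have shQ : shadow alpha GQ lam a B.
  move=> b Bb; have [ba hb] := sh b Bb; split=> // th th1 th2.
  have [c' hc'] := hb th th1 th2; exists (invmx Q *m c').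
  by rewrite /GQ -mulmxA mulKVmx.
have wx : `|xpart (lsubmx GQ)| = `|lsubmx GQ (lshift n r1) 0| by rewrite kapE wE.
have wy : `|ypart (lsubmx GQ)| <= 1 by rewrite wE.
have kap1 : lam^-1 <= `|lsubmx GQ (lshift n r1) 0| <= 1 by rewrite kapE k1.
have slopeQ c' : `|xpart (GQ *m c')| <=
    2 * `|lsubmx GQ (lshift n r1) 0| * `|ypart (GQ *m c')| \/
    1 <= 2 * `|lsubmx GQ (lshift n r1) 0|.
  by rewrite kapE /GQ -mulmxA; exact: slope.
have [s0 hratio] := pivot_ratio lam1 GQ0 wx wy kap1.
have sh2 := shadow_pivot lam1 a0 wx wy kap1 slopeQ shQ.
have a50 : 0 < 5 * a by rewrite mulr_gt0.
have cov2 := hC _ _ _ _ lam1 a50 s0 sh2.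
apply: cov_le (cov_pivot lam1 a0 wx kap1 slopeQ shQ eta0 _ cov2); last first.
  by rewrite mulr_ge0 ?powR_ge0// ltW.
have ratioE : maxminor (expandx m n lam *m GQ) / maxminor GQ =
    maxminor (expandx m n lam *m G) / maxminor G.
  rewrite mQ -[GQ]mul1mx mQ mul1mx; field.
  by rewrite dQ gt_eqF.
rewrite ratioE in hratio.
set q' := maxminor (expandx m n lam *m schur _ _) / _ in hratio *.
set q := maxminor _ / maxminor G in hratio *.
set kap : R := `|_| in hratio kap1 *.
have q0 : 0 <= q by rewrite divr_ge0 ?maxminor_ge0.
have q'0 : 0 <= q' by rewrite divr_ge0 ?maxminor_ge0.
have lk0 : 0 <= lam * kap := mulr_ge0 (ltW lam0) (normr_ge0 _).
have hpow : (lam * kap) `^ alpha * q' `^ alpha <= k.+1%:R * q `^ alpha.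
  rewrite -powRM//; apply: (@le_trans _ _ ((k.+1%:R * q) `^ alpha)).
    by rewrite ge0_ler_powR// nnegrE mulr_ge0.
  by rewrite powRM// ler_wpM2r ?powR_ge0// ler1_powR// ler1n.
apply: (@le_trans _ _ (C2 * q `^ alpha)); last first.
  by rewrite ler_wpM2r ?powR_ge0// lerDr ltW.
rewrite (_ : C * _ * _ = C * (12 / eta + 1) * ((lam * kap) `^ alpha * q' `^ alpha)); last by ring.
rewrite /C2 -[leRHS]mulrA ler_pM2l// mulr_gt0//.
by rewrite addr_gt0// divr_gt0.
Qed.

End CoverStepInduction.

(** * The diagonal flow *)

Lemma maxminor_mulmx_unit (R : realFieldType) D k (M : 'M[R]_D) (G : 'M[R]_(D, k)) :
  M \in unitmx -> 0 < maxminor G -> 0 < maxminor (M *m G).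
Proof.
move=> uM /maxminor_gt0P[f uf]; apply/maxminor_gt0P.
have fG : row_full (M *m G).
  rewrite /row_full (eqmxMfull G) ?row_full_unit// eqn_leq rank_leq_col /=.
  by rewrite -[leqLHS](mxrank_unit uf) mxrankS ?rowsub_sub.
by exists (fullrankfun fG); exact: fullrowsub_unit.
Qed.

Section Flow.
Variables (R : realType) (m n : nat).
Hypotheses (m_gt0 : (0 < m)%N) (n_gt0 : (0 < n)%N).
Variable A : 'M[R]_(m, n).
Local Notation d := (m + n)%N.
Local Notation xpart v := (usubmx (v : 'cV[R]_(m + n))).
Local Notation ypart v := (dsubmx (v : 'cV[R]_(m + n))).

Definition flow (t : R) : 'M[R]_(m + n) := aflow m n t *m uA A.

Lemma flow_col t p (x : 'M[R]_(m, p)) (y : 'M[R]_(n, p)) : flow t *m col_mx x y =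
  col_mx (expR (t / m%:R) *: (x + A *m y)) (expR (- t / n%:R) *: y).
Proof.
rewrite /flow -mulmxA /uA mul_block_col !mul1mx mul0mx add0r.
by rewrite /aflow mul_block_col !mul0mx addr0 add0r !mul_scalar_mx.
Qed.

Lemma flow_unit t : flow t \in unitmx.
Proof.
rewrite unitmx_mul !unitmxE /uA /aflow !det_ublock !det1 !det_scalar mul1r unitr1 andbT.
by rewrite unitrM !unitfE !expf_neq0// gt_eqF// expR_gt0.
Qed.

Let mR : 0 < m%:R :> R. Proof. by rewrite ltr0n. Qed.
Let nR : 0 < n%:R :> R. Proof. by rewrite ltr0n. Qed.

Lemma det_flow t : \det (flow t) = 1.
Proof.
rewrite det_mulmx /uA /aflow !det_ublock !det1 !det_scalar !mulr1.
rewrite -!expRM_natl -expRD (_ : _ + _ = 0) ?expR0//.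
by field; rewrite !gt_eqF.
Qed.

Lemma flow_scale t s p (G : 'M[R]_(m + n, p)) :
  expandx m n (expR (s * (m%:R^-1 + n%:R^-1))) *m (flow t *m G) =
  expR (s / n%:R) *: (flow (t + s) *m G).
Proof.
rewrite -[G]vsubmxK !flow_col expandxE col_mxKu col_mxKd scale_col_mx !scalerA.
by rewrite -!expRD; congr col_mx; congr (expR _ *: _); field; rewrite !gt_eqF.
Qed.

Lemma cv_norm_le_parts (v : 'cV[R]_(m + n)) a : 0 <= a ->
  `|xpart v| <= a -> `|ypart v| <= a -> `|v| <= a.
Proof. by move=> a0 h1 h2; apply: cvnorm_le => //; exact: cv_entry_le. Qed.

Lemma xpart_le (v : 'cV[R]_(m + n)) : `|xpart v| <= `|v|.
Proof. by apply: cvnorm_le => // i; rewrite mxE cvnorm_ge. Qed.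

Lemma ypart_le (v : 'cV[R]_(m + n)) : `|ypart v| <= `|v|.
Proof. by apply: cvnorm_le => // i; rewrite mxE cvnorm_ge. Qed.

Lemma intmx_eq0 p q (z : 'M[int]_(p, q)) : intmx R z = 0 -> z = 0.
Proof.
move=> h; apply/matrixP => i j; move/matrixP/(_ i j): h.
by rewrite !mxE => /eqP; rewrite intr_eq0 => /eqP.
Qed.

Lemma flow_int_neq0 t (z : 'cV[int]_(m + n)) : z != 0 -> flow t *m intmx R z != 0.
Proof.
apply: contra => /eqP h; apply/eqP/intmx_eq0.
by rewrite -(mulKmx (flow_unit t) (intmx R z)) h mulmx0.
Qed.

Lemma lambda1_le t (z : 'cV[int]_(m + n)) : z != 0 -> lambda1 A t <= `|flow t *m intmx R z|.
Proof.
move=> z0; apply: ge_inf; first by exists 0 => _ [v _ <-].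
exists (flow t *m intmx R z) => //; split; first by exists z.
by move=> /= h; have := flow_int_neq0 t z0; rewrite h eqxx.
Qed.

Lemma lambda1_ge t r :
  (forall z : 'cV[int]_(m + n), z != 0 -> r <= `|flow t *m intmx R z|) -> r <= lambda1 A t.
Proof.
move=> h; apply: lb_le_inf.
  pose z : 'cV[int]_(m + n) := const_mx 1.
  have z0 : z != 0.
    apply/eqP => /matrixP/(_ (lshift n (Ordinal m_gt0)) 0); rewrite !mxE => /eqP.
    by rewrite oner_eq0.
  exists `|flow t *m intmx R z|, (flow t *m intmx R z) => //; split; first by exists z.
  by move=> /= e; have := flow_int_neq0 t z0; rewrite e eqxx.
move=> _ [_ [[z _ <-] /= zn0] <-]; apply: h; apply/eqP => z0; apply: zn0.
by rewrite z0 (_ : intmx R _ = 0) ?mulmx0// /intmx map_mx0.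
Qed.

(** Over a time at most s the flow contracts no vector by more than e^(s/n). A small minimum at a
    sampled time therefore forces small minima on the whole preceding interval. *)
Lemma lambda1_shift t t' s : t' - s <= t -> t <= t' ->
  lambda1 A t <= expR s * lambda1 A t'.
Proof.
move=> h1 h2; have s0 : 0 <= s by lra.
rewrite mulrC -ler_pdivrMr ?expR_gt0//; apply: lambda1_ge => z z0.
rewrite ler_pdivrMr ?expR_gt0//; apply: (le_trans (lambda1_le t z0)).
rewrite -[intmx R z]vsubmxK !flow_col; set x := _ + _; set y := dsubmx _.
set v := (X in _ <= `|X| * _).
apply: cv_norm_le_parts.
- by rewrite mulr_ge0 ?expR_ge0.
- apply: le_trans (_ : `|xpart v| <= _); last first.
    by apply: (le_trans (xpart_le v)); rewrite ler_peMr// -expR0 ler_expR.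
  rewrite /v !col_mxKu !normrZ !ger0_norm ?expR_ge0// ler_wpM2r// ler_expR.
  by rewrite ler_pM2r ?invr_gt0.
- apply: le_trans (_ : `|ypart v| * expR s <= _); last first.
    by rewrite ler_wpM2r ?expR_ge0 ?ypart_le.
  rewrite /v !col_mxKd !normrZ !ger0_norm ?expR_ge0// mulrAC ler_wpM2r// -expRD ler_expR.
  rewrite ler_pdivrMr// mulrDl divfK ?gt_eqF//.
  have : s <= s * n%:R by rewrite ler_peMr// ler1n.
  lra.
Qed.

Lemma mulmx_norm_le p q (M : 'M[R]_(p, q)) (v : 'cV[R]_q) :
  `|M *m v| <= (\sum_i \sum_j `|M i j|) * `|v|.
Proof.
have S0 i : 0 <= \sum_j `|M i j| by apply: sumr_ge0.
apply: cvnorm_le => [|i]; first by rewrite mulr_ge0// sumr_ge0.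
rewrite mxE (bigD1 i)//= mulrDl; apply: ler_wpDr.
  by rewrite mulr_ge0// sumr_ge0.
apply: (le_trans (ler_norm_sum _ _ _)); rewrite mulr_suml; apply: ler_sum => j _.
by rewrite normrM ler_wpM2l// cvnorm_ge.
Qed.

Lemma lambda1_gt0 t : 0 < lambda1 A t.
Proof.
set K := \sum_i \sum_j `|invmx (flow t) i j|.
have K0 : 0 < K + 1 by rewrite ltr_wpDl// sumr_ge0// => i _; rewrite sumr_ge0.
apply: (@lt_le_trans _ _ (K + 1)^-1); first by rewrite invr_gt0.
apply: lambda1_ge => z z0; rewrite -[leLHS]mul1r ler_pdivrMr//.
have : 1 <= `|intmx R z|.
  rewrite leNgt; apply/negP => /intmx_small z0'; by rewrite z0' eqxx in z0.
move=> /le_trans; apply; rewrite -{1}(mulKmx (flow_unit t) (intmx R z)).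
apply: (le_trans (mulmx_norm_le _ _)); rewrite -/K mulrC ler_wpM2l// lerDl.
exact: ler01.
Qed.

(* The points [x] whose grid has a vector of norm at most [eps] at all times
   after [t0]. *)
Definition shortset (t0 eps : R) : set 'cV[R]_m :=
  [set x | `|x| <= 1 /\ forall t, t0 <= t -> exists (p : 'cV[int]_m) (q : 'cV[int]_n),
    `|A *m intmx R q - intmx R p - x| <= eps * expR (- t / m%:R) /\
    `|intmx R q| <= eps * expR (t / n%:R)]%classic.

Lemma intmx_col_mx p q (x : 'cV[int]_p) (y : 'cV[int]_q) :
  intmx R (col_mx x y) = col_mx (intmx R x) (intmx R y).
Proof. exact: map_col_mx. Qed.

Lemma expRN_m (t : R) : expR (t / m%:R) * expR (- t / m%:R) = 1.
Proof. by rewrite -expRD mulNr subrr expR0. Qed.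

Lemma expRN_n (t : R) : expR (- t / n%:R) * expR (t / n%:R) = 1.
Proof. by rewrite -expRD mulNr addNr expR0. Qed.

Lemma expR_div_le (s : R) k : (0 < k)%N -> 0 <= s -> expR (s / k%:R) <= expR s.
Proof. by move=> k0 s0; rewrite ler_expR ler_pdivrMr ?ltr0n// ler_peMr// ler1n. Qed.

Lemma cov_stable t0 eps t s N : 0 <= eps -> 0 <= s -> t0 <= t + s ->
  4 * eps * expR s < lambda1 A (t + s) ->
  cov (shortset t0 eps) (2 * (eps * expR (- t / m%:R))) N ->
  cov (shortset t0 eps) (2 * (eps * expR (- (t + s) / m%:R))) N.
Proof.
move=> eps0 s0 t0s hlam [T [l [cT h]]]; exists T, l; split=> // x y Xx Xy exy.
have := h _ _ Xx Xy exy => xy.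
have [_ /(_ _ t0s)[px [qx [hx1 hx2]]]] := Xx.
have [_ /(_ _ t0s)[py [qy [hy1 hy2]]]] := Xy.
set vx := _ - x in hx1; set vy := _ - y in hy1.
pose z : 'cV[int]_(m + n) := col_mx (py - px) (qx - qy).
have zx : intmx R (py - px) + A *m intmx R (qx - qy) = (vx - vy) + (x - y).
  rewrite !intmxB mulmxBr /vx /vy; move: (A *m _) (A *m _) => u v.
  by apply/matrixP => i j; rewrite !mxE; ring.
have e1 : 1 <= expR s by rewrite -expR0 ler_expR.
(* The two grid vectors contribute 2 eps, and the diameter of the piece, expanded from time t to t +
   s, contributes 2 eps e^(s/m). *)
have nz : `|flow (t + s) *m intmx R z| <= 4 * eps * expR s.
  rewrite intmx_col_mx flow_col zx; apply: cv_norm_le_parts.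
  - by rewrite !mulr_ge0 ?expR_ge0.
  - rewrite col_mxKu normrZ ger0_norm ?expR_ge0//.
    have hv : `|vx - vy + (x - y)| <=
        2 * (eps * expR (- (t + s) / m%:R)) + 2 * (eps * expR (- t / m%:R)).
      apply: (le_trans (ler_normD _ _)); apply: lerD => //.
      by apply: (le_trans (ler_normB _ _)); lra.
    apply: (le_trans (ler_wpM2l (expR_ge0 _) hv)).
    rewrite mulrDr !(mulrCA (expR _)) expRN_m -expRD.
    rewrite (_ : (t + s) / m%:R + - t / m%:R = s / m%:R); last by ring.
    have := ler_wpM2l eps0 (expR_div_le m_gt0 s0).
    have := ler_wpM2l eps0 e1; lra.
  - rewrite col_mxKd normrZ ger0_norm ?expR_ge0//.
    have hq : `|intmx R (qx - qy)| <= 2 * (eps * expR ((t + s) / n%:R)).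
      by rewrite intmxB; apply: (le_trans (ler_normB _ _)); lra.
    apply: (le_trans (ler_wpM2l (expR_ge0 _) hq)).
    rewrite !(mulrCA (expR _)) expRN_n.
    have := ler_wpM2l eps0 e1; lra.
have z0 : z = 0.
  apply: contraTeq hlam => z0; rewrite -leNgt; exact: le_trans (lambda1_le _ z0) nz.
have xyE : x - y = vy - vx.
  have : intmx R (py - px) + A *m intmx R (qx - qy) = 0.
    have := congr1 (@usubmx _ m n 1) z0; have := congr1 (@dsubmx _ m n 1) z0.
    rewrite /z col_mxKu col_mxKd => -> ->; rewrite !linear0 /= /intmx !map_mx0 mulmx0 addr0//.
  rewrite zx => /eqP; rewrite addrC addr_eq0 => /eqP ->; by rewrite opprB.
by rewrite xyE; apply: (le_trans (ler_normB _ _)); lra.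
Qed.

End Flow.

(** * Steps of the flow inside the cusp *)

Section Unstable.
Variables (R : realType) (m n : nat).
Hypotheses (m_gt0 : (0 < m)%N) (n_gt0 : (0 < n)%N).
Variable A : 'M[R]_(m, n).
Local Notation xpart v := (usubmx (v : 'cV[R]_(m + n))).
Local Notation ypart v := (dsubmx (v : 'cV[R]_(m + n))).

Let mR : 0 < m%:R :> R. Proof. by rewrite ltr0n. Qed.
Let nR : 0 < n%:R :> R. Proof. by rewrite ltr0n. Qed.
Let dE : (m + n)%:R = m%:R + n%:R :> R. Proof. exact: natrD. Qed.
Let dR : 0 < (m + n)%:R :> R. Proof. by rewrite ltr0n addn_gt0 m_gt0. Qed.

Definition slopexp : R := n%:R / (m + n)%:R.

Lemma slopexp_ge0 : 0 <= slopexp. Proof. by rewrite divr_ge0. Qed.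

Lemma slopexp_le1 : slopexp <= 1.
Proof. by rewrite ler_pdivrMr// mul1r ler_nat leq_addl. Qed.

Lemma expR_slopexp (u : R) :
  expR (- u * (m%:R^-1 + n%:R^-1)) `^ slopexp = expR (- u / m%:R).
Proof.
rewrite -expRM; congr expR; rewrite /slopexp dE.
by field; rewrite !gt_eqF// addr_gt0.
Qed.

Lemma expR_slopexpB1 (u : R) :
  expR (- u * (m%:R^-1 + n%:R^-1)) `^ (slopexp - 1) = expR (u / n%:R).
Proof.
rewrite -expRM; congr expR; rewrite /slopexp dE.
by field; rewrite !gt_eqF// addr_gt0.
Qed.

Definition spanning (t r : R) k (P : 'M[int]_(m + n, k)) :=
  forall z : 'cV[int]_(m + n), `|flow A t *m intmx R z| <= r ->
    exists c : 'cV[R]_k, intmx R z = intmx R P *m c.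

(** Subtracting one grid vector, chosen at time t for all of [U], turns the short grid vectors at
    times t + tau into lattice vectors. Seen at time t + s, each of these has norm at most 4 eps
    e^s, so one condition at the final time puts them all in the column space of [P]. *)
Lemma shadow_shortset t0 eps t s k (P : 'M[int]_(m + n, k)) (U : set 'cV[R]_m) p0 q0 :
  0 < eps -> 0 <= s -> t0 <= t -> spanning (t + s) (4 * eps * expR s) P ->
  (U `<=` shortset A t0 eps)%classic ->
  `|intmx R q0| <= eps * expR (t / n%:R) ->
  (forall x, U x -> `|A *m intmx R q0 - intmx R p0 - x| <= 3 * (eps * expR (- t / m%:R))) ->
  shadow slopexp (flow A t *m intmx R P) (expR (s * (m%:R^-1 + n%:R^-1))) (4 * eps)
    [set expR (t / m%:R) *: (x - (A *m intmx R q0 - intmx R p0)) | x in U]%classic.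
Proof.
move=> eps0 s0 t0t sp UX hq0 hp0 _ [x Ux <-].
set xc := _ - intmx R p0 in hp0 *; set b := expR _ *: _.
have ba : `|b| <= 3 * eps.
  rewrite /b normrZ ger0_norm ?expR_ge0// -normrN opprB.
  apply: (le_trans (ler_wpM2l (expR_ge0 _) (hp0 _ Ux))).
  by rewrite !(mulrCA (expR _)) expRN_m mulr1.
split=> [|th th1 th2]; first by move: ba; lra.
set kap := m%:R^-1 + n%:R^-1 in th1 *.
have kap0 : 0 < kap by rewrite addr_gt0// invr_gt0.
have th0 : 0 < th by apply: lt_le_trans th1; rewrite invr_gt0 expR_gt0.
pose tau := - ln th / kap.
have thE : th = expR (- tau * kap).
  by rewrite /tau [_ * kap]mulNr divfK ?gt_eqF// opprK lnK.
have tau0 : 0 <= tau.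
  by rewrite /tau divr_ge0// ?(ltW kap0)// oppr_ge0 -ln1 ler_ln ?posrE.
have taus : tau <= s.
  rewrite /tau ler_pdivrMr// lerNl -(expRK (- (s * kap))).
  by rewrite ler_ln ?posrE ?expR_gt0// expRN.
have t0tau : t0 <= t + tau by lra.
have [_ /(_ _ t0tau)[p [q [h1 h2]]]] := UX _ Ux.
pose z : 'cV[int]_(m + n) := col_mx (p0 - p) (q - q0).
have zE t' : flow A t' *m intmx R z =
    col_mx (expR (t' / m%:R) *: ((A *m intmx R q - intmx R p - x) + (x - xc)))
      (expR (- t' / n%:R) *: (intmx R q - intmx R q0)).
  rewrite intmx_col_mx flow_col !intmxB mulmxBr; congr col_mx; congr (_ *: _).
  rewrite /xc; move: (A *m _) (A *m _) => u v.
  by apply/matrixP => i j; rewrite !mxE; ring.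
set v := _ - x in h1 zE.
have hv : expR (t / m%:R) * `|v| <= eps * expR (- tau / m%:R).
  apply: (le_trans (ler_wpM2l (expR_ge0 _) h1)); rewrite mulrCA -expRD.
  by rewrite (_ : _ + _ = - tau / m%:R)//; ring.
have hy : expR (- t / n%:R) * `|intmx R q - intmx R q0| <= 2 * (eps * expR (tau / n%:R)).
  have hq : `|intmx R q - intmx R q0| <= eps * expR ((t + tau) / n%:R) + eps * expR (t / n%:R).
    by apply: (le_trans (ler_normB _ _)); apply: lerD.
  apply: (le_trans (ler_wpM2l (expR_ge0 _) hq)).
  rewrite mulrDr !(mulrCA (expR _)) expRN_n -expRD.
  rewrite (_ : - t / n%:R + (t + tau) / n%:R = tau / n%:R); last by ring.
  have : 1 <= expR (tau / n%:R) by rewrite -expR0 ler_expR divr_ge0.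
  by move=> /(ler_wpM2l (ltW eps0)); lra.
have [|c hc] := sp z.
  rewrite zE; apply: cv_norm_le_parts.
  - by rewrite !mulr_ge0 ?expR_ge0 ?(ltW eps0).
  - rewrite col_mxKu normrZ ger0_norm ?expR_ge0//.
    rewrite (_ : (t + s) / m%:R = s / m%:R + t / m%:R); last by ring.
    rewrite expRD -[leLHS]mulrA [leLHS]mulrC; apply: ler_pM.
    + by rewrite mulr_ge0 ?expR_ge0.
    + exact: expR_ge0.
    + apply: (le_trans (ler_wpM2l (expR_ge0 _) (ler_normD _ _))); rewrite mulrDr.
      have : expR (t / m%:R) * `|x - xc| <= 3 * eps.
        by move: ba; rewrite /b normrZ ger0_norm ?expR_ge0.
      have : expR (- tau / m%:R) <= 1.
        by rewrite -expR0 ler_expR mulNr oppr_le0 divr_ge0.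
      move=> /(ler_wpM2l (ltW eps0)); move: hv; lra.
    + exact: expR_div_le.
  - rewrite col_mxKd normrZ ger0_norm ?expR_ge0//.
    rewrite (_ : - (t + s) / n%:R = - s / n%:R + - t / n%:R); last by ring.
    rewrite expRD -[leLHS]mulrA; apply: (le_trans (ler_wpM2l (expR_ge0 _) hy)).
    rewrite !(mulrCA (expR _)) -expRD.
    have : expR (- s / n%:R + tau / n%:R) <= 1.
      rewrite (_ : - s / n%:R + tau / n%:R = (tau - s) / n%:R); last by ring.
      by rewrite -[leRHS]expR0 ler_expR ler_pdivrMr// mul0r subr_le0.
    have : 1 <= expR s by rewrite -expR0 ler_expR.
    move=> /(ler_wpM2l (ltW eps0)) e1 /(ler_wpM2l (ltW eps0)); move: e1; lra.
exists c; rewrite -mulmxA -hc zE col_mxKu col_mxKd thE expR_slopexp expR_slopexpB1; split.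
  rewrite scalerDr -/b addrK normrZ ger0_norm ?expR_ge0//.
  apply: (le_trans hv); rewrite ler_wpM2r ?expR_ge0//; lra.
rewrite normrZ ger0_norm ?expR_ge0//; apply: (le_trans hy).
have e24 : 2 * eps <= 4 * eps by lra.
by rewrite [leLHS]mulrA; exact: (ler_wpM2r (expR_ge0 _) e24).
Qed.

(** Diameter: half of a = 4 eps is 2 eps. Count: [expandx] differs from the flow by e^(s/n) on each
    of k columns, and raising e^(sk/n) to the power n/d gives e^(sk/d). *)
Lemma cov_unstable k C (C0 : 0 < C)
  (hC : forall (G : 'M[R]_(m + n, k)) (lam a : R) (B : set 'cV[R]_m), 1 <= lam ->
    0 < a -> 0 < maxminor G -> shadow slopexp G lam a B ->
    cov B (2^-1 * (a * lam `^ (- slopexp)))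
      (C * (maxminor (expandx m n lam *m G) / maxminor G) `^ slopexp))
  t0 eps t s (P : 'M[int]_(m + n, k)) (U : set 'cV[R]_m) :
  0 < eps -> 0 <= s -> t0 <= t -> spanning (t + s) (4 * eps * expR s) P ->
  0 < maxminor (flow A t *m intmx R P) ->
  (U `<=` shortset A t0 eps)%classic ->
  (forall x y, U x -> U y -> `|x - y| <= 2 * (eps * expR (- t / m%:R))) ->
  cov U (2 * (eps * expR (- (t + s) / m%:R)))
    (C * (expR (s * (k%:R / (m + n)%:R)) *
      (maxminor (flow A (t + s) *m intmx R P) / maxminor (flow A t *m intmx R P)) `^ slopexp)).
Proof.
move=> eps0 s0 t0t sp P0 UX dU.
have [p0 [q0 [hq0 hp0]]] : exists (p0 : 'cV[int]_m) (q0 : 'cV[int]_n),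
    `|intmx R q0| <= eps * expR (t / n%:R) /\
    forall x, U x -> `|A *m intmx R q0 - intmx R p0 - x| <= 3 * (eps * expR (- t / m%:R)).
  have [[x0 Ux0]|U0] := pselect (exists x, U x).
    have [_ /(_ _ t0t)[p0 [q0 [h1 h2]]]] := UX _ Ux0; exists p0, q0; split=> // x Ux.
    have -> : A *m intmx R q0 - intmx R p0 - x =
        (A *m intmx R q0 - intmx R p0 - x0) + (x0 - x) by rewrite [RHS]addrA subrK.
    by apply: (le_trans (ler_normD _ _)); have := dU _ _ Ux0 Ux; lra.
  exists 0, 0; split; last by move=> x Ux; case: U0; exists x.
  rewrite (_ : intmx R _ = 0) ?normr0 ?mulr_ge0 ?expR_ge0// ?(ltW eps0)//.
  by rewrite /intmx map_mx0.
have sh := shadow_shortset eps0 s0 t0t sp UX hq0 hp0.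
set lam := expR _ in sh.
have lam1 : 1 <= lam.
  by rewrite /lam -expR0 ler_expR mulr_ge0// addr_ge0// invr_ge0 ltW.
have eps4 : 0 < 4 * eps by rewrite mulr_gt0.
have [T [l [cT h]]] := hC _ _ _ _ lam1 eps4 P0 sh.
have lamE : lam `^ (- slopexp) = expR (- s / m%:R).
  rewrite -powR_inv ?expR_ge0// /lam -expRN -mulNr; exact: expR_slopexp.
set pr := fun x : 'cV[R]_m => _ in h sh.
exists T, (l \o pr); split.
  apply: (le_trans cT); apply: ler_wpM2l; first exact: ltW.
  rewrite /lam.
  rewrite (flow_scale m_gt0 n_gt0 A t s).
  rewrite maxminorZ.
  rewrite ger0_norm; last exact: expR_ge0.
  rewrite -[X in X `^ _]mulrA powRM; last 2 first.
  - by rewrite exprn_ge0// expR_ge0.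
  - by rewrite divr_ge0 ?maxminor_ge0.
  rewrite -expRM_natl -expRM.
  rewrite (_ : _ * slopexp = s * (k%:R / (m + n)%:R)); first exact: lexx.
  by rewrite /slopexp; field; rewrite !gt_eqF// addr_gt0.
move=> x y Ux Uy /= exy; have := h _ _ (imageP pr Ux) (imageP pr Uy) exy.
have eB (u v w : 'cV[R]_m) : u - w - (v - w) = u - v by rewrite opprB addrA subrK.
rewrite /pr -scalerBr eB normrZ ger0_norm ?expR_ge0// lamE.
move=> /(ler_wpM2l (expR_ge0 (- t / m%:R))) h3.
have e3 : expR (- t / m%:R) * (expR (t / m%:R) * `|x - y|) = `|x - y|.
  by rewrite mulrA [X in X * _]mulrC expRN_m mul1r.
rewrite e3 in h3; apply: (le_trans h3).
rewrite (_ : - (t + s) / m%:R = - t / m%:R + - s / m%:R); last by ring.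
rewrite expRD; set u := expR _; set v := expR _.
by rewrite le_eqVlt; apply/orP; left; apply/eqP; field.
Qed.

End Unstable.

(** * Growth of the coverings *)

Lemma powR_mul_ratio (R : realType) (x y w a : R) : 0 < x -> 0 <= y -> 0 <= w ->
  (x * w) `^ a * (y / x) `^ a = (y * w) `^ a.
Proof.
move=> x0 y0 w0; rewrite -powRM ?divr_ge0 ?mulr_ge0 ?(ltW x0)//.
by rewrite (_ : x * w * (y / x) = y * w)//; field; rewrite gt_eqF.
Qed.

Section Growth.
Variables (R : realType) (m n : nat).
Hypotheses (m_gt0 : (0 < m)%N) (n_gt0 : (0 < n)%N).
Variable A : 'M[R]_(m, n).
Local Notation d := (m + n)%N.
Local Notation mm t P := (maxminor (flow A t *m intmx R P)).

Let dR : 0 < d%:R :> R. Proof. by rewrite ltr0n addn_gt0 m_gt0. Qed.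

(* Adjoining a short vector outside the span multiplies [mm t P * M ^+ k] by at
   most 1, and this can happen at most [d] times. *)
Lemma extend_spanning (t r M : R) k (P : 'M[int]_(d, k)) : 0 <= r -> 0 < M ->
  d%:R * r * M <= 1 -> 0 < mm t P ->
  exists k' (P' : 'M[int]_(d, k')), [/\ 0 < mm t P',
    mm t P' * M ^+ k' <= mm t P * M ^+ k & spanning A t r P'].
Proof.
move=> r0 M0 hr; elim: {k}(d - k)%N {-2}k (erefl (d - k)%N) P => [|l IH] k kl P P0.
all: have [sp|nsp] := pselect (spanning A t r P); first by exists k, P.
all: have [z [zr zP]] : exists z : 'cV[int]_d, `|flow A t *m intmx R z| <= r /\
    ~ exists c : 'cV[R]_k, intmx R z = intmx R P *m c.
1, 3: apply: contrapT => h; apply: nsp => z zr; apply: contrapT => h'; by apply: h; exists z.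
all: pose P' : 'M[int]_(d, k.+1) := row_mx z P.
all: have P'E : flow A t *m intmx R P' =
    row_mx (flow A t *m intmx R z) (flow A t *m intmx R P) :> 'M[R]_(d, 1 + k).
1, 3: by rewrite -mul_mx_row; congr (_ *m _); exact: map_row_mx.
all: have P'0 : 0 < mm t P'.
1, 3: rewrite lt_neqAle maxminor_ge0 andbT eq_sym P'E; apply/eqP => h0;
  have [c hc] := maxminor_span P0 h0; apply: zP; exists c;
  apply: (can_inj (mulKmx (flow_unit A t))); by rewrite mulmxA.
- by have := maxminor_leq P'0; rewrite -subn_gt0 kl.
have kd := maxminor_leq P'0.
have [|k' [P'' [h1 h2 h3]]] := IH k.+1 _ P' P'0; first by rewrite subnS kl.
exists k', P''; split=> //; apply: (le_trans h2).
have : mm t P' <= k.+1%:R * r * mm t P.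
  rewrite P'E; apply: maxminor_row_mx_le => // i.
  by apply: le_trans zr; exact: cvnorm_ge.
move=> /(ler_wpM2r (exprn_ge0 k.+1 (ltW M0))) h; apply: (le_trans h).
rewrite exprS [leLHS](_ : _ = k.+1%:R * r * M * (mm t P * M ^+ k)); last by ring.
rewrite ler_piMl ?mulr_ge0 ?maxminor_ge0 ?exprn_ge0 ?(ltW M0)//.
apply: le_trans hr; rewrite ler_wpM2r ?(ltW M0)// ler_wpM2r//.
by rewrite ler_nat.
Qed.

(** Hermite's inequality with k * k replaced by d * k, so that the bound is a k-th power: once M la
    is at least 4^d, every weight is at least 1. *)
Lemma weight_ge (t la M : R) k (P : 'M[int]_(d, k)) : 0 < la -> la <= lambda1 A t -> 0 < M ->
  0 < mm t P -> (M * la * (4^-1) ^+ d) ^+ k <= mm t P * M ^+ k.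
Proof.
move=> la0 hla M0 P0; have kd := maxminor_leq P0.
have h : (4^-1) ^+ (k * k) * la ^+ k <= mm t P.
  apply: maxminor_lattice => // z z0; apply: (le_trans hla).
  rewrite -mulmxA -intmxM; apply: lambda1_le => //.
  apply: contra z0 => /eqP Pz; apply/eqP; apply: (@intmx_eq0 R).
  apply: (maxminor_inj P0); rewrite -mulmxA -intmxM Pz.
  by rewrite /intmx map_mx0 mulmx0.
apply: le_trans (ler_wpM2r (exprn_ge0 k (ltW M0)) h).
have c0 : 0 <= 4^-1 :> R by rewrite invr_ge0.
rewrite exprM -!exprMn; apply: lerXn2r; rewrite ?nnegrE.
- by rewrite !mulr_ge0 ?exprn_ge0// ltW.
- by rewrite !mulr_ge0 ?exprn_ge0// ltW.
rewrite [leLHS]mulrC -[leRHS]mulrA (mulrC la); apply: ler_wpM2r; first by rewrite mulr_ge0// ltW.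
by apply: ler_wiXn2l => //; rewrite invf_le1// ler1n.
Qed.

Lemma cov_step_unif N : exists2 C : R, 1 <= C & forall k, (k < N)%N ->
  forall (G : 'M[R]_(d, k)) (lam a : R) (B : set 'cV[R]_m), 1 <= lam ->
    0 < a -> 0 < maxminor G -> shadow (slopexp R m n) G lam a B ->
    cov B (2^-1 * (a * lam `^ (- slopexp R m n)))
      (C * (maxminor (expandx m n lam *m G) / maxminor G) `^ slopexp R m n).
Proof.
elim: N => [|N [C C1 hC]]; first by exists 1.
have half0 : 0 < 2^-1 :> R by rewrite invr_gt0.
have [C' C'0 hC'] := @cov_step R m n _ (slopexp_ge0 R m n) (slopexp_le1 R n m_gt0) N _ half0.
exists (C + C'); first by rewrite ler_wpDr// ltW.
move=> k; rewrite ltnS leq_eqVlt => /orP[/eqP ->|kN] G lam a B h1 h2 h3 h4.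
  apply: cov_le (hC' G lam a B h1 h2 h3 h4); apply: ler_wpM2r; first exact: powR_ge0.
  by rewrite ler_wpDl// (le_trans ler01).
apply: cov_le (hC k kN G lam a B h1 h2 h3 h4); apply: ler_wpM2r; first exact: powR_ge0.
by rewrite ler_wpDr// ltW.
Qed.

(** The determinant of [P] is a nonzero integer and the flow has determinant 1. *)
Lemma mm_square_ge1 t k (P : 'M[int]_(d, k)) : 0 < mm t P -> k = d -> 1 <= mm t P.
Proof.
move=> P0 kd; move: P P0; rewrite kd => P /maxminor_gt0P[f].
rewrite -mul_rowsub_mx unitmx_mul => /andP[_ uP].
apply: le_trans (maxminor_ge _ id).
rewrite (_ : rowsub id _ = flow A t *m intmx R P); last first.
  by apply/matrixP => i j; rewrite !mxE.
rewrite det_mulmx det_flow// mul1r; move: uP; rewrite unitmxE unitfE /intmx det_map_mx.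
by rewrite intr_eq0 -intr_norm ler1z -gtz0_ge1 normr_gt0.
Qed.


Local Notation tj t0 s j := (t0 + j%:R * s).
(** Step i is judged at its right end, the time at which the covering lemmas ask about short lattice
    vectors. *)
Definition short_count (t0 s delta : R) j : nat :=
  (\sum_(i < j) (lambda1 A (tj t0 s i.+1) <= delta)%R)%N.

Lemma short_countS t0 s delta j : short_count t0 s delta j.+1 =
  (short_count t0 s delta j + (lambda1 A (tj t0 s j.+1) <= delta)%R)%N.
Proof. exact: big_ord_recr. Qed.

Section Induction.
Variables (C s delta M eps t0 A0 : R).
Hypotheses (C1 : 1 <= C) (s0 : 0 <= s) (delta0 : 0 < delta) (eps0 : 0 < eps).
Hypothesis hC : forall k, (k < d.+1)%N ->
  forall (G : 'M[R]_(d, k)) (lam a : R) (B : set 'cV[R]_m), 1 <= lam ->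
    0 < a -> 0 < maxminor G -> shadow (slopexp R m n) G lam a B ->
    cov B (2^-1 * (a * lam `^ (- slopexp R m n)))
      (C * (maxminor (expandx m n lam *m G) / maxminor G) `^ slopexp R m n).
Hypotheses (M1 : 1 < M) (Md : 1 <= M * delta * (4^-1) ^+ d).
Hypotheses (Me : d%:R * (4 * eps * expR s) * M <= 1) (ed : 4 * eps * expR s <= delta).
Let M0 : 0 < M. Proof. exact: lt_trans M1. Qed.
Let M00 := ltW M0.
Let Cs := C * expR (s * ((d%:R - 1) / d%:R)).
Let alpha := slopexp R m n.
Let alpha0 : 0 <= alpha := slopexp_ge0 R m n.

Let Cs1 : 1 <= Cs.
Proof.
rewrite /Cs mulr_ege1// -[leLHS]expR0 ler_expR mulr_ge0// divr_ge0// subr_ge0.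
by rewrite ler1n addn_gt0 m_gt0.
Qed.

Let mm_shift t k (P : 'M[int]_(d, k)) : 0 < mm t P -> forall t', 0 < mm t' P.
Proof.
move=> P0 t'.
have -> : flow A t' *m intmx R P = (flow A t' *m invmx (flow A t)) *m (flow A t *m intmx R P).
  by rewrite -[RHS]mulmxA mulKmx// flow_unit.
by apply: maxminor_mulmx_unit P0; rewrite unitmx_mul unitmx_inv !flow_unit.
Qed.

Hypothesis hA0 : forall k (P : 'M[int]_(d, k)), 0 < mm t0 P ->
  cov (shortset A t0 eps) (2 * (eps * expR (- t0 / m%:R)))
    (A0 * (mm t0 P * M ^+ k) `^ alpha).
Hypothesis A00 : 0 <= A0.

Let mm_empty t : mm t (0 : 'M[int]_(d, 0)) = 1.
Proof. exact: maxminor0. Qed.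

(* The bound is proved for all [P] at once: at an unstable step [P] is first
   replaced by a subspace of no larger weight containing all short vectors, and
   the quotient of minors given by [cov_unstable] then turns the weight at time
   t into the weight at time t + s. *)
Lemma cov_growth_weighted j k (P : 'M[int]_(d, k)) : 0 < mm (tj t0 s j) P ->
  cov (shortset A t0 eps) (2 * (eps * expR (- tj t0 s j / m%:R)))
    (A0 * Cs ^+ short_count t0 s delta j * (mm (tj t0 s j) P * M ^+ k) `^ alpha).
Proof.
elim: j k P => [|j IH] k P P0.
  rewrite /short_count big_ord0 expr0 mulr1 mul0r addr0.
  by apply: hA0; move: P0; rewrite mul0r addr0.
have tjS : tj t0 s j.+1 = tj t0 s j + s by rewrite -natr1 mulrDl mul1r addrA.
have t0j : t0 <= tj t0 s j by rewrite lerDl mulr_ge0.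
have AC0 i : 0 <= A0 * Cs ^+ i.
  by rewrite mulr_ge0// exprn_ge0// (le_trans ler01 Cs1).
have E0 : 0 < mm (tj t0 s j) (0 : 'M[int]_(d, 0)) by rewrite mm_empty.
have [hl|hl] := ltP delta (lambda1 A (tj t0 s j.+1)).
  have hc : short_count t0 s delta j.+1 = short_count t0 s delta j.
    by rewrite short_countS leNgt hl addn0.
  (* All weights are at least 1 here, so the bound for the empty [P] is enough. *)
  have g1 : 1 <= mm (tj t0 s j.+1) P * M ^+ k.
    by apply: le_trans (weight_ge delta0 (ltW hl) M0 P0); exact: exprn_ege1.
  have cE := IH _ _ E0; rewrite mm_empty expr0 mulr1 powR1 mulr1 in cE.
  apply: (@cov_le _ _ _ _ (A0 * Cs ^+ short_count t0 s delta j)).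
    rewrite hc ler_peMr//; rewrite -[leLHS](_ : 1 `^ alpha = 1); last by rewrite powR1.
    by apply: ge0_ler_powR; rewrite ?nnegrE ?(le_trans ler01 g1).
  have t0s : t0 <= tj t0 s j + s by rewrite (le_trans t0j)// lerDl.
  rewrite tjS; apply: (cov_stable m_gt0 (ltW eps0) s0 t0s _ cE).
  by rewrite -tjS; exact: le_lt_trans ed hl.
have hc : short_count t0 s delta j.+1 = (short_count t0 s delta j).+1.
  by rewrite short_countS hl addn1.
(* Take the lighter of [P] and the empty matrix: its weight is at most 1, and extending it cannot
   reach rank d. *)
have [k0 [P1 [P10 g1 g2]]] : exists k0 (P1 : 'M[int]_(d, k0)),
    [/\ 0 < mm (tj t0 s j.+1) P1, mm (tj t0 s j.+1) P1 * M ^+ k0 <= 1 &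
        mm (tj t0 s j.+1) P1 * M ^+ k0 <= mm (tj t0 s j.+1) P * M ^+ k].
  have [h|h] := leP (mm (tj t0 s j.+1) P * M ^+ k) 1; first by exists k, P.
  by exists 0%N, 0; rewrite mm_empty expr0 mulr1; split=> //; exact: ltW.
have r0 : 0 <= 4 * eps * expR s by rewrite !mulr_ge0 ?expR_ge0// ltW.
have [k2 [P2 [P20 h2 sp2]]] := extend_spanning r0 M0 Me P10.
have k2d : (k2 < d)%N.
  rewrite ltn_neqAle (maxminor_leq P20) andbT; apply/eqP => k2d.
  have : 1 < mm (tj t0 s j.+1) P2 * M ^+ k2.
    apply: lt_le_trans (_ : M ^+ k2 <= _).
      by rewrite exprn_egt1// k2d -lt0n addn_gt0 m_gt0.
    by rewrite ler_peMl ?exprn_ge0//; exact: (mm_square_ge1 P20).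
  by rewrite ltNge (le_trans h2 g1).
have P2j : 0 < mm (tj t0 s j) P2 by exact: mm_shift P20 _.
have C0 : 0 < C by exact: lt_le_trans C1.
rewrite tjS in sp2 P20 h2 g2 *; rewrite -[in X in cov _ _ X]tjS.
have hU := cov_unstable m_gt0 n_gt0 C0 (hC (leqW k2d)) eps0 s0 t0j sp2 P2j.
apply: cov_le (cov_refine _ (IH _ _ P2j) hU); last first.
  by rewrite mulr_ge0 ?(ltW C0)// mulr_ge0 ?expR_ge0 ?powR_ge0.
set X := mm (tj t0 s j) P2 in P2j *; set Y := mm (_ + s) P2 in P20 h2 *.
have powE : (X * M ^+ k2) `^ alpha * (Y / X) `^ alpha = (Y * M ^+ k2) `^ alpha.
  exact: powR_mul_ratio P2j (ltW P20) (exprn_ge0 k2 M00).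
have rg (u c e f g : R) : u * f * (c * (e * g)) = u * (c * e) * (f * g).
  by ring.
rewrite rg powE.
rewrite hc exprSr; apply: ler_pM.
- by rewrite mulr_ge0 ?AC0// mulr_ge0 ?expR_ge0// ltW.
- exact: powR_ge0.
- rewrite [leRHS]mulrA; apply: ler_wpM2l; first exact: AC0.
  rewrite /Cs; apply: ler_wpM2l; first exact: ltW.
  rewrite ler_expR; apply: ler_wpM2l => //; rewrite ler_pM2r ?invr_gt0//.
  by rewrite lerBrDr natr1 ler_nat.
- rewrite tjS; apply: ge0_ler_powR => //; rewrite ?nnegrE.
  + exact: mulr_ge0 (ltW P20) (exprn_ge0 _ M00).
  + exact: mulr_ge0 (maxminor_ge0 _) (exprn_ge0 _ M00).
  + exact: le_trans h2 g2.
Qed.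

End Induction.

(** The order of the quantifiers is what the conclusion needs: C precedes [s] and [delta], so s can
    be chosen to dominate ln C, and [eps] precedes [t0], so all starting times share one [eps]. *)
Lemma cov_growth : exists2 C : R, 1 <= C & forall s delta : R, 0 <= s -> 0 < delta ->
  exists2 eps : R, 0 < eps & forall t0 : R, exists2 A0 : R, 0 <= A0 & forall j,
    cov (shortset A t0 eps) (2 * (eps * expR (- tj t0 s j / m%:R)))
      (A0 * (C * expR (s * ((d%:R - 1) / d%:R))) ^+ short_count t0 s delta j).
Proof.
have [C C1 hC] := cov_step_unif d.+1.
exists C => // s delta s0 delta0.
have p4 : 1 <= 4 ^+ d :> R by rewrite exprn_ege1// ler1n.
have p40 : 0 < 4 ^+ d :> R by rewrite exprn_gt0.
have [M M1 Mdel] : exists2 M : R, 1 < M & 4 ^+ d <= M * delta.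
  exists (4 ^+ d / delta + 2).
    by rewrite ltr_wpDl ?divr_ge0 ?exprn_ge0 ?(ltW delta0)// ltr1n.
  by rewrite mulrDl divfK ?gt_eqF// lerDl mulr_ge0// ltW.
have M0 : 0 < M by exact: lt_trans M1.
have Md : 1 <= M * delta * (4^-1) ^+ d.
  by rewrite exprVn ler_pdivlMr// mul1r.
have den0 : 0 < 4 * expR s * d%:R * M by rewrite !mulr_gt0// expR_gt0.
pose eps := (4 * expR s * d%:R * M)^-1.
have eps0 : 0 < eps by rewrite invr_gt0.
have rE : 4 * eps * expR s = (d%:R * M)^-1.
  by rewrite /eps; field; rewrite -natrD !gt_eqF ?expR_gt0.
have Me : d%:R * (4 * eps * expR s) * M <= 1.
  by rewrite rE le_eqVlt; apply/orP; left; apply/eqP; field; rewrite -natrD !gt_eqF.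
have ed : 4 * eps * expR s <= delta.
  rewrite rE -[leLHS]div1r ler_pdivrMr ?mulr_gt0//.
  apply: (le_trans p4); apply: (le_trans Mdel).
  rewrite mulrC ler_wpM2l ?(ltW delta0)// ler_peMl ?(ltW M0)//.
  by rewrite ler1n addn_gt0 m_gt0.
exists eps => // t0.
pose la := lambda1 A t0.
have la0 : 0 < la by exact: lambda1_gt0.
(* Capping at 1 makes c1^d a lower bound for the weights of every rank at time [t0]; [A0] divides by
   its power to cover the initial box. *)
pose c1 := Num.min 1 (M * la * (4^-1) ^+ d).
have c10 : 0 < c1.
  by rewrite lt_min ltr01 !mulr_gt0// exprn_gt0// invr_gt0.
have c11 : c1 <= 1 by rewrite ge_min lexx.
pose c := c1 ^+ d.
have c0 : 0 < c by rewrite exprn_gt0.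
pose alpha := slopexp R m n.
have alpha0 : 0 <= alpha := slopexp_ge0 R m n.
have rho0 : 0 < 2 * (eps * expR (- t0 / m%:R)) by rewrite !mulr_gt0// expR_gt0.
pose N0 := (2 * 1 / (2 * (eps * expR (- t0 / m%:R))) + 1) ^+ m.
have N00 : 0 <= N0 by rewrite exprn_ge0// addr_ge0// divr_ge0// ltW.
pose A0 := N0 / c `^ alpha.
have A00 : 0 <= A0 by rewrite divr_ge0// powR_ge0.
exists A0 => // j.
have hA0 k (P : 'M[int]_(d, k)) : 0 < mm t0 P ->
  cov (shortset A t0 eps) (2 * (eps * expR (- t0 / m%:R)))
    (A0 * (mm t0 P * M ^+ k) `^ alpha).
  move=> P0; apply: cov_le (cov_box ler01 rho0 _); last by move=> x [].
  rewrite -/N0 /A0 mulrAC ler_pdivlMr ?powR_gt0//; apply: ler_wpM2l => //.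
  apply: ge0_ler_powR => //; rewrite ?nnegrE ?(ltW c0)//.
    by rewrite mulr_ge0 ?maxminor_ge0 ?exprn_ge0// ltW.
  apply: le_trans (weight_ge la0 (lexx _) M0 P0).
  apply: (@le_trans _ _ (c1 ^+ k)).
    by apply: ler_wiXn2l; rewrite ?(ltW c10) ?c11// (maxminor_leq P0).
  by apply: lerXn2r; rewrite ?nnegrE ?(ltW c10)// ?(le_trans (ltW c10))// ge_min lexx orbT.
have E0 : 0 < mm (tj t0 s j) (0 : 'M[int]_(d, 0)) by rewrite maxminor0.
have := cov_growth_weighted C1 s0 delta0 eps0 hC M1 Md Me ed hA0 A00 E0.
by rewrite maxminor0 expr0 mulr1 powR1 mulr1.
Qed.

End Growth.

(** * Hausdorff measure zero *)

Section HausdorffNull.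
Variables (R : realType) (X : metricType R) (s : R).
Hypothesis s0 : 0 < s.
Local Open Scope classical_set_scope.
Local Open Scope ereal_scope.

Lemma diam_pow_ge0 (U : set X) : 0 <= diam_pow s U.
Proof. by rewrite /diam_pow; case: ifP => // _; exact: poweR_ge0. Qed.

Lemma diam_pow_le (U : set X) (r : R) : (0 <= r)%R ->
  (forall x y, U x -> U y -> (mdist x y <= r)%R) -> diam_pow s U <= (r `^ s)%:E.
Proof.
move=> r0 h; rewrite /diam_pow; case: ifPn => [_|/set0P[x Ux]].
  by rewrite lee_fin powR_ge0.
rewrite -poweR_EFin; apply: gt0_ler_poweR; first exact: ltW.
- rewrite in_itv /= leey andbT; apply: ereal_sup_ubound; exists (x, x) => //=.
  by rewrite mdistxx.
- by rewrite in_itv /= leey andbT lee_fin.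
- by apply: ge_ereal_sup => _ [[a b] /= [Ua Ub] <-]; rewrite lee_fin h.
Qed.

Lemma ediam_le (U : set X) (r : R) :
  (forall x y, U x -> U y -> (mdist x y <= r)%R) -> ediam U <= r%:E.
Proof.
by move=> h; apply: ge_ereal_sup => _ [[a b] /= [Ua Ub] <-]; rewrite lee_fin h.
Qed.

Definition fin_cover (E : set X) (N : nat) (r : R) := exists F : nat -> set X,
  (forall x, E x -> exists2 k, (k < N)%N & F k x) /\
  forall k x y, F k x -> F k y -> (mdist x y <= r)%R.

(** Each [E i] needs one efficient covering below every scale. The i-th is given the share e /
    2^(i+1), and the countably many finite families are merged into one sequence through a bijection
    of nat with pairs. *)
Lemma hausdorff_measure_null (S : set X) (E : nat -> set X) : S `<=` \bigcup_i E i ->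
  (forall i (e r0 : R), (0 < e)%R -> (0 < r0)%R -> exists N r,
    [/\ (0 <= r <= r0)%R, (N%:R * r `^ s <= e)%R & fin_cover (E i) N r]) ->
  hausdorff_measure s S = 0.
Proof.
move=> SE hE; apply/eqP; rewrite eq_le; apply/andP; split; last first.
  apply: ereal_sup_ge; exists (hausdorff_premeasure s 1 S); first by exists 1%R => //=.
  apply: le_ereal_inf_tmp => _ [F _ <-]; apply: nneseries_ge0 => i _ _; exact: diam_pow_ge0.
apply: ge_ereal_sup => _ [r0 /= r00 <-]; apply/lee_addgt0Pr => e e0; rewrite add0e.
have /choice[f hf] : forall i, exists Nr : nat * R,
    [/\ (0 <= Nr.2 <= r0)%R, (Nr.1%:R * Nr.2 `^ s <= e / (2 ^ i.+1)%:R)%R &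
      fin_cover (E i) Nr.1 Nr.2].
  move=> i; have [||N [r h]] := hE i (e / (2 ^ i.+1)%:R)%R r0 => //.
    by rewrite divr_gt0// ltr0n expn_gt0.
  by exists (N, r).
have /choice[F hF] : forall i, exists F : nat -> set X,
    (forall x, E i x -> exists2 k, (k < (f i).1)%N & F k x) /\
    forall k x y, F k x -> F k y -> (mdist x y <= (f i).2)%R.
  by move=> i; have [_ _ h] := hf i.
pose G i k : set X := if (k < (f i).1)%N then F i k else set0.
have Gd i k x y : G i k x -> G i k y -> (mdist x y <= (f i).2)%R.
  by rewrite /G; case: ifP => // _; have [_ h] := hF i; exact: h.
have /card_esym/ppcard_eqP[g] := card_nat2.
apply: (@le_trans _ _ (\sum_(0 <= l <oo) diam_pow s (uncurry G (g l)))).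
  apply: ereal_inf_lbound; exists (uncurry G \o g) => //; split.
    move=> x /SE[i _ Ex]; have [h _] := hF i; have [k kN Fk] := h _ Ex.
    exists (g^-1%FUN (i, k)) => //=; rewrite invK ?inE//= /uncurry /G kN.
    exact: Fk.
  move=> l; rewrite /=; case: (g l) => i k /=; apply: ediam_le => x y Gx Gy.
  by apply: le_trans (Gd _ _ _ _ Gx Gy) _; have [/andP[_ h] _ _] := hf i.
rewrite nneseries_esumT; last by move=> l; exact: diam_pow_ge0.
rewrite -(@reindex_esum _ _ _ setT setT g (fun p => diam_pow s (uncurry G p))); last first.
  exact: bij.
rewrite (_ : [set: nat * nat] = [set: nat] `*`` (fun=> [set: nat])); last first.
  by apply/seteqP; split=> -[].
rewrite (_ : esum _ _ =
    \esum_(i in [set: nat]) \esum_(k in [set: nat]) diam_pow s (G i k)); last first.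
  rewrite esum_esum; last by move=> i k _ _; exact: diam_pow_ge0.
  by apply: eq_esum => -[i k].
apply: (@le_trans _ _ (\sum_(0 <= i <oo) (e / (2 ^ i.+1)%:R)%:E)); last first.
  exact: (epsilon_trick0 xpredT (ltW e0)).
rewrite nneseries_esumT; last first.
  by move=> i; rewrite lee_fin divr_ge0// ltW.
apply: le_esum => i _; rewrite -nneseries_esumT; last by move=> k; exact: diam_pow_ge0.
rewrite (nneseries_split 0 (f i).1); last by move=> k _; exact: diam_pow_ge0.
rewrite add0n [X in _ + X]eseries0 ?adde0; last first.
  by move=> k Nk _; rewrite /G ltnNge Nk /= /diam_pow eqxx.
have [/andP[r1 _] h _] := hf i.
apply: (@le_trans _ _ (\sum_(0 <= k < (f i).1) ((f i).2 `^ s)%:E)).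
  apply: lee_sum => k _; apply: diam_pow_le => //; exact: Gd.
by rewrite sumEFin lee_fin sumr_const_nat subn0 -[leLHS]mulr_natl.
Qed.

End HausdorffNull.

(** * Escape of mass *)

Section EscapeCount.
Variables (R : realType) (m n : nat).
Hypotheses (m_gt0 : (0 < m)%N) (n_gt0 : (0 < n)%N).
Variable A : 'M[R]_(m, n).
Local Open Scope classical_set_scope.
Local Open Scope ring_scope.

(** Each counted step contributes its whole interval of length s; half-open intervals keep the
    contributions disjoint. *)
Lemma short_count_measure (t0 s delta delta' : R) j (r : R) :
  0 <= t0 -> 0 < s -> expR s * delta <= delta' -> t0 + j%:R * s <= r ->
  ((s * (short_count A t0 s delta j)%:R)%:E <= lebesgue_measure
    [set t | t \in `[0%R, r] /\ (lambda1 A t <= delta')%R])%E.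
Proof.
move=> t00 s0 hd hr.
pose tj i := t0 + i%:R * s.
pose I i : set R := if lambda1 A (tj i.+1) <= delta then `]tj i, tj i.+1]%classic else set0.
pose V := fix V i := if i is i'.+1 then V i' `|` I i' else (set0 : set R).
have tjS i : tj i.+1 = tj i + s by rewrite /tj -natr1 mulrDl mul1r addrA.
have IP i t : I i t -> lambda1 A (tj i.+1) <= delta /\ tj i < t <= tj i.+1.
  by rewrite /I; case: (lambda1 A _ <= _) => // Ht; split=> //; move: Ht; rewrite /mkset in_itv.
have Vsub i : V i `<=` [set t | t \in `[0, tj i] /\ (lambda1 A t <= delta')].
  elim: i => [|i IH] t // [/IH[h1 h2]|].
    split=> //; move: h1; rewrite !in_itv /= => /andP[t1 t2]; rewrite t1 /=.
    by rewrite tjS (le_trans t2)// lerDl ltW.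
  move=> /IP[hl /andP[t1 t2]].
  have t0i : 0 <= tj i by rewrite addr_ge0// mulr_ge0// ltW.
  split; first by rewrite in_itv /= t2 (le_trans t0i)// ltW.
  apply: le_trans hd; apply: (@le_trans _ _ (expR s * lambda1 A (tj i.+1))).
    by apply: lambda1_shift => //; rewrite tjS addrK ltW.
  by rewrite ler_wpM2l ?expR_ge0.
have mI i : measurable (I i) by rewrite /I; case: ifP.
have mV i : measurable (V i).
  by elim: i => //= i IH; exact: measurableU.
have VE i : lebesgue_measure (V i) = (s * (short_count A t0 s delta i)%:R)%:E.
  elim: i => [|i IH]; first by rewrite measure0 /short_count big_ord0 mulr0.
  have VI : V i `&` I i = set0.
    apply/seteqP; split=> // t [/Vsub[h _]].
    have /andP[_ t1] : 0 <= t <= tj i by move: h; rewrite in_itv.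
    by move=> /IP[_ /andP[t2 _]]; move: t2; rewrite ltNge t1.
  rewrite [LHS](measureU lebesgue_measure (mV i) (mI i) VI).
  rewrite [X in (X + _)%E]IH short_countS -/(tj i.+1) natrD mulrDr EFinD; congr (_ + _)%E.
  rewrite /I; case: (lambda1 A _ <= _); last by rewrite measure0 mulr0.
  apply: (etrans (lebesgue_measure_itv _)); rewrite /= lte_fin tjS ltrDl s0 mulr1 -EFinD.
  by congr EFin; rewrite addrC addKr.
rewrite -VE; apply: (@le_trans _ _ (lebesgue_measure
    [set t | t \in `[0, tj j] /\ (lambda1 A t <= delta')])).
  exact: le_mu_ext.
apply: le_mu_ext => t [/= h1 h2]; split=> //; move: h1; rewrite !in_itv /= => /andP[-> h1].
exact: le_trans hr.
Qed.

End EscapeCount.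

(** * From singular points of the torus to short grid vectors *)

Section SingCover.
Variables (R : realType) (m n : nat).
Hypotheses (m_gt0 : (0 < m)%N) (n_gt0 : (0 < n)%N).
Variable A : 'M[R]_(m, n).
Local Open Scope classical_set_scope.
Local Open Scope ring_scope.

Lemma torus_dist_pi_le (x y : 'cV[R]_m) :
  torus_dist (\pi_(torus R m)%qT x) (\pi_(torus R m)%qT y) <= `|x - y|.
Proof.
rewrite torus_distE; apply: ge_inf; first by exists 0 => _ [p _ <-].
by exists 0 => //; rewrite intmx0 subr0.
Qed.

Lemma torus_repr_le1 (b : torus R m) : exists2 x, \pi_(torus R m)%qT x = b & `|x| <= 1.
Proof.
pose p : 'cV[int]_m := map_mx Num.floor (repr b).
exists (repr b - intmx R p).
  rewrite -[RHS]reprK; apply/eqP/torus_piP; exists (- p).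
  by rewrite intmxN addrAC subrr add0r.
apply: cvnorm_le => // i; rewrite !mxE.
have /andP[h1 h2] := floor_itv (repr b i 0).
rewrite intrD in h2; rewrite ler_norml; apply/andP; split; lra.
Qed.

Lemma Sing_sub (eps : R) : 0 < eps ->
  Sing A (psi_pow (n%:R / m%:R)) `<=`
  \bigcup_i [set \pi_(torus R m)%qT x | x in shortset A i%:R eps].
Proof.
move=> eps0 b hb; have [x xb x1] := torus_repr_le1 b.
(* With T = eps e^(t/n) this choice gives c T^(-n/m) = eps e^(-t/m). *)
pose c := eps * eps `^ (n%:R / m%:R).
have c0 : 0 < c by rewrite mulr_gt0// powR_gt0.
have := hb c c0; rewrite -xb => /Dset_pi[T0 [_ hT0]].
pose i := Num.bound (n%:R * `|T0| / eps).
exists i => //; exists x => //; split=> // t it.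
have nR : 0 < n%:R :> R by rewrite ltr0n.
have mR : 0 < m%:R :> R by rewrite ltr0n.
have hi : n%:R * `|T0| / eps < i%:R.
  by apply: archi_boundP; rewrite divr_ge0 ?mulr_ge0// ltW.
have T0t : T0 < eps * expR (t / n%:R).
  apply: (le_lt_trans (ler_norm _)).
  apply: (@lt_le_trans _ _ (eps * (1 + t / n%:R))); last first.
    by rewrite ler_pM2l// expR_ge1Dx.
  have : `|T0| < eps * (t / n%:R).
    rewrite mulrA ltr_pdivlMr// -ltr_pdivrMl// mulrC.
    by apply: lt_le_trans it; rewrite (mulrC `|T0|).
  by rewrite mulrDr mulr1; lra.
have [p [q [h1 h2]]] := hT0 _ T0t.
exists p, q; split=> //; apply: (le_trans h1).
rewrite /c /psi_pow powRM ?expR_ge0 ?(ltW eps0)// -expRM powRN.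
rewrite (_ : t / n%:R * - (n%:R / m%:R) = - t / m%:R); last first.
  by field; rewrite !gt_eqF.
rewrite mulrA -(mulrA eps) divff ?mulr1//.
by rewrite gt_eqF// powR_gt0.
Qed.

Lemma fin_cover_torus t0 eps rho (N : R) : 0 <= rho ->
  cov (shortset A t0 eps) rho N -> exists2 k : nat, k%:R <= N &
  fin_cover [set \pi_(torus R m)%qT x | x in shortset A t0 eps] k rho.
Proof.
move=> rho0 [T [l [cT h]]]; exists #|T| => //.
exists (fun k => [set \pi_(torus R m)%qT x | x in
  [set x | shortset A t0 eps x /\ enum_rank (l x) = k :> nat]]).
split=> [_ [x Xx <-]|k _ _ [x [Xx xk] <-] [y [Xy yk] <-]].
  by exists (enum_rank (l x)) => //; exists x.
apply: le_trans (torus_dist_pi_le x y) _; apply: h => //.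
by apply: enum_rank_inj; apply: val_inj; rewrite /= xk.
Qed.

End SingCover.

(** * The lower escape of mass as an infimum over thresholds *)

Section EmassFacts.
Variables (R : realType) (m n : nat) (A : 'M[R]_(m, n)).
Local Open Scope classical_set_scope.
Local Open Scope ring_scope.
Local Open Scope ereal_scope.

Let phi (delta : R) : \bar R := limf_einf (escape_freq A delta) (pinfty_nbhs R).

Lemma escape_freq_ge0 (delta r : R) : (0 < r)%R -> 0 <= escape_freq A delta r.
Proof. by move=> r0; rewrite mule_ge0// lee_fin invr_ge0 ltW. Qed.

Lemma liminf_escape_ge0 delta : 0 <= phi delta.
Proof.
rewrite /phi limf_einfE.
apply: (@le_trans _ _ (ereal_inf (escape_freq A delta @` [set r : R | (0 < r)%R]))).
  by apply: le_ereal_inf_tmp => _ [r /= r0 <-]; exact: escape_freq_ge0.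
apply: ereal_sup_ubound; exists [set r : R | (0 < r)%R] => //.
by exists 0%R.
Qed.

Lemma liminf_escape_le (d1 d2 : R) : (d1 <= d2)%R -> phi d1 <= phi d2.
Proof.
move=> d12; rewrite /phi !limf_einfE; apply: ge_ereal_sup => _ [V hV <-].
pose W := V `&` [set r : R | (0 < r)%R].
apply: (@le_trans _ _ (ereal_inf (escape_freq A d2 @` W))); last first.
  apply: ereal_sup_ubound; exists W => //; apply: filterI => //.
  by exists 0%R.
apply: le_ereal_inf_tmp => _ [r [Vr /= r0] <-].
apply: (@le_trans _ _ (escape_freq A d1 r)); first by apply: ereal_inf_lbound; exists r.
rewrite /escape_freq lee_pmul2l ?lte_fin ?invr_gt0//.
by apply: le_mu_ext => t [h1 h2]; split=> //; exact: le_trans d12.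
Qed.

Lemma lower_EmassE : lower_Emass A = ereal_inf (phi @` [set delta | (0 < delta)%R]).
Proof.
have := @nondecreasing_at_right_cvge _ phi 0%R +oo%O isT.
rewrite (_ : [set` `]0%R, +oo[] = [set delta : R | (0 < delta)%R]); last first.
  by apply/seteqP; split=> x /=; rewrite in_itv /= andbT.
move=> h; apply/cvg_lim => //; apply: h => x y _ _; exact: liminf_escape_le.
Qed.

Lemma lower_Emass_ge0 : 0 <= lower_Emass A.
Proof.
by rewrite lower_EmassE; apply: le_ereal_inf_tmp => _ [x _ <-]; exact: liminf_escape_ge0.
Qed.

Lemma escape_freq_frequently (E : R) : lower_Emass A < E%:E ->
  exists2 delta : R, (0 < delta)%R & forall r0 : R, exists2 r : R, (r0 < r)%R &
    escape_freq A delta r < E%:E.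
Proof.
rewrite lower_EmassE => /ereal_inf_lt[_ [delta /= d0 <-] hphi].
exists delta => // r0; apply: contrapT => h; move: hphi.
rewrite ltNge => /negP; apply; rewrite /phi limf_einfE.
apply: (@le_trans _ _ (ereal_inf (escape_freq A delta @` [set r : R | (r0 < r)%R]))).
  apply: le_ereal_inf_tmp => _ [r /= r0r <-]; rewrite leNgt; apply/negP => hr.
  by apply: h; exists r.
apply: ereal_sup_ubound; exists [set r : R | (r0 < r)%R] => //.
by exists r0; split; [exact: num_real|].
Qed.

End EmassFacts.

(** * The dimension bound *)

Section Conclusion.
Variables (R : realType) (m n : nat).
Hypotheses (m_gt0 : (0 < m)%N) (n_gt0 : (0 < n)%N).
Variable A : 'M[R]_(m, n).
Local Notation d := (m + n)%N.
Local Open Scope ring_scope.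

Let mR : 0 < m%:R :> R. Proof. by rewrite ltr0n. Qed.

Lemma expR_decay (K kap e : R) : 0 <= K -> 0 < kap -> 0 < e ->
  exists r0, forall r, r0 < r -> K * expR (- (kap * r)) <= e.
Proof.
move=> K0 k0 e0; exists (K / e / kap) => r hr.
rewrite expRN ler_pdivrMr ?expR_gt0// -ler_pdivrMl// mulrC.
apply: le_trans (expR_ge1Dx _); apply: (@le_trans _ _ (kap * r)); last by rewrite lerDr.
by rewrite [leRHS]mulrC -ler_pdivrMr// ltW.
Qed.

Lemma Sing_measure0 (E sg : R) : lower_Emass A = E%:E -> 0 < sg ->
  m%:R * ((d%:R - 1) / d%:R) * E < sg ->
  hausdorff_measure sg (Sing A (psi_pow (n%:R / m%:R))) = 0%E.
Proof.
move=> EE sg0 hsg.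
have E0 : 0 <= E by rewrite -lee_fin -EE lower_Emass_ge0.
set q := (d%:R - 1) / d%:R in hsg.
have q0 : 0 <= q.
  by rewrite divr_ge0// subr_ge0 ler1n addn_gt0 m_gt0.
have g0 : 0 < sg / m%:R - q * E.
  by rewrite subr_gt0 ltr_pdivlMr// mulrC mulrA.
have w0 : 0 < q + E + 1 by rewrite ltr_wpDl// addr_ge0.
(* Chosen so that (q + e1)(E + e1) stays below sg/m; the cap at 1 bounds e1^2 by e1. *)
pose e1 := Num.min 1 ((sg / m%:R - q * E) / (q + E + 1) / 2).
have e10 : 0 < e1 by rewrite lt_min ltr01 !divr_gt0.
have e11 : e1 <= 1 by rewrite ge_min lexx.
have e12 : e1 * (q + E + 1) < sg / m%:R - q * E.
  apply: (@le_lt_trans _ _ ((sg / m%:R - q * E) / 2)); last by rewrite ltr_pdivrMr//; lra.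
  apply: (@le_trans _ _ ((sg / m%:R - q * E) / (q + E + 1) / 2 * (q + E + 1))).
    by rewrite ler_pM2r// ge_min lexx orbT.
  by rewrite mulrAC divfK ?gt_eqF.
pose kap := sg / m%:R - (q + e1) * (E + e1).
have kap0 : 0 < kap.
  rewrite subr_gt0; apply: (@le_lt_trans _ _ (q * E + e1 * (q + E + 1))).
    have : e1 * e1 <= e1 * 1 by rewrite ler_pM2l.
    lra.
  by move: e12; lra.
have [C C1 hC] := cov_growth m_gt0 n_gt0 A.
(* Now C is at most e^(s e1): the constant lost at each step costs only [e1] per unit of time. *)
pose s := ln C / e1 + 1.
have C0 : 0 < C by exact: lt_le_trans C1.
have s0 : 0 < s by rewrite ltr_wpDl// divr_ge0 ?ln_ge0// ltW.
have hCs : C * expR (s * q) <= expR (s * (q + e1)).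
  rewrite mulrDr expRD mulrC ler_pM2l ?expR_gt0// -{1}(lnK C0) ler_expR.
  by rewrite /s mulrDl divfK ?gt_eqF// mul1r lerDl (ltW e10).
have [|delta' delta'0 hfreq] := @escape_freq_frequently R m n A (E + e1).
  by rewrite EE lte_fin ltrDl.
pose delta := expR (- s) * delta'.
have delta0 : 0 < delta by rewrite mulr_gt0// expR_gt0.
have hd : expR s * delta <= delta' by rewrite /delta mulrA -expRD subrr expR0 mul1r.
have [eps eps0 hgrow] := hC s delta (ltW s0) delta0.
apply: (hausdorff_measure_null sg0 (Sing_sub m_gt0 n_gt0 eps0)) => i e r0 e0 r00.
have [A0 A00 hcov] := hgrow i%:R.
pose B := A0 * (2 * eps * expR (s / m%:R)) `^ sg.
have B0 : 0 <= B by rewrite mulr_ge0// powR_ge0.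
have [r1 hr1] := expR_decay B0 kap0 e0.
have D0 : 0 <= 2 * eps * expR (s / m%:R) by rewrite !mulr_ge0 ?expR_ge0// ltW.
have [r2 hr2] := expR_decay D0 (divr_gt0 ltr01 mR) r00.
pose rr0 := Num.max (Num.max r1 r2) (i%:R + s).
have [rr hrr hf] := hfreq rr0.
move: hrr; rewrite !gt_max => /andP[/andP[rr1 rr2] rri].
have i0 : 0 <= i%:R :> R by [].
have rrp : 0 < rr by apply: le_lt_trans rri; rewrite addr_ge0// ltW.
(* The last full step before [rr]; the missing time, less than s, is paid for by the factor e^(s/m)
   in [B]. *)
pose j := Num.truncn ((rr - i%:R) / s).
have /andP[j1 j2] : j%:R * s <= rr - i%:R < j%:R * s + s.
  have /truncn_itv : 0 <= (rr - i%:R) / s by rewrite divr_ge0 ?(ltW s0)//; lra.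
  rewrite -/j -natr1 ler_pdivlMr// ltr_pdivrMr// => /andP[-> h].
  by move: h; rewrite mulrDl mul1r.
have tj1 : i%:R + j%:R * s <= rr by lra.
pose cnt := short_count A i%:R s delta j.
have hcnt : s * cnt%:R <= (E + e1) * rr.
  have := short_count_measure m_gt0 n_gt0 A i0 s0 hd tj1 => h.
  move: hf; rewrite /escape_freq lte_pdivrMl// => hf.
  rewrite -lee_fin; apply: (le_trans h); apply: (le_trans (ltW hf)).
  by rewrite -EFinM lee_fin [leLHS]mulrC.
pose rho := 2 * (eps * expR (- (i%:R + j%:R * s) / m%:R)).
have rho0 : 0 < rho by rewrite !mulr_gt0// expR_gt0.
have hrho : rho <= 2 * eps * expR (s / m%:R) * expR (- (rr / m%:R)).
  rewrite /rho -!mulrA ler_pM2l// ler_pM2l// -expRD ler_expR.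
  rewrite (_ : s / m%:R + - (rr / m%:R) = (s - rr) / m%:R); last by ring.
  by rewrite ler_pM2r ?invr_gt0//; lra.
have [k kN hk] := fin_cover_torus (ltW rho0) (hcov j).
exists k, rho; split=> //.
  rewrite (ltW rho0) /=; apply: (le_trans hrho).
  by have := hr2 _ rr2; rewrite (_ : 1 / m%:R * rr = rr / m%:R)//; ring.
have hpow : rho `^ sg <= (2 * eps * expR (s / m%:R)) `^ sg * expR (- (sg / m%:R * rr)).
  rewrite (_ : - (sg / m%:R * rr) = - (rr / m%:R) * sg); last by ring.
  rewrite [X in _ <= _ * X]expRM -powRM ?expR_ge0//.
  apply: ge0_ler_powR => //; rewrite ?nnegrE; [exact: ltW|exact: ltW|].
  by rewrite !mulr_ge0 ?expR_ge0// ltW.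
have hN : k%:R <= A0 * expR ((q + e1) * ((E + e1) * rr)).
  apply: (le_trans kN); apply: ler_wpM2l => //.
  apply: (@le_trans _ _ (expR (s * (q + e1)) ^+ cnt)).
    apply: lerXn2r => //; rewrite nnegrE ?expR_ge0//.
    by rewrite mulr_ge0 ?expR_ge0// ltW.
  rewrite -expRM_natl ler_expR mulrA [leLHS]mulrC; apply: ler_wpM2l.
    by rewrite addr_ge0// ltW.
  by rewrite mulrC.
(* The exponents (q + e1)(E + e1) of the count and -sg/m of the diameters add up to -kap, hence
   decay in [rr]. *)
apply: le_trans (ler_pM _ _ hN hpow) _ => //; first exact: powR_ge0.
apply: le_trans (hr1 _ rr1).
rewrite mulrACA -expRD /B (_ : _ + _ = - (kap * rr)) ?lexx//.
by rewrite /kap; ring.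
Qed.

End Conclusion.

Theorem proposition2p4 (R : realType) (m n : nat) (m_gt0 : (0 < m)%N)
    (n_gt0 : (0 < n)%N) (A : 'M[R]_(m, n)) :
  (hausdorff_dim (Sing A (psi_pow (n%:R / m%:R)))
   <= (m%:R * (((m + n)%:R - 1) / (m + n)%:R))%:E * lower_Emass A)%E.
Proof.
have d1 : 1 < (m + n)%:R :> R.
  by rewrite ltr1n -addn1 leq_add.
have mR : 0 < m%:R :> R by rewrite ltr0n.
have c0 : 0 < m%:R * (((m + n)%:R - 1) / (m + n)%:R) :> R.
  by rewrite mulr_gt0// divr_gt0 ?subr_gt0// (lt_trans ltr01).
have := lower_Emass_ge0 A; case EE : (lower_Emass A) => [E| |] E0 //; last first.
  (* If the escape of mass were infinite, the right-hand side would be too, since d is at least 2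
     and the coefficient is positive. *)
  by rewrite gt0_muley ?lte_fin// leey.
apply/lee_addgt0Pr => e e0; rewrite -EFinM -EFinD.
apply: ereal_inf_lbound; eexists; last reflexivity; split.
  by rewrite addr_ge0 ?(ltW e0)// mulr_ge0// ltW.
apply: (Sing_measure0 m_gt0 n_gt0 EE); last by rewrite ltrDl.
by rewrite ltr_wpDl// mulr_ge0// ltW.
Qed.
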